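(* The following are generating functions of the form $A(t)F(xtA(t)-R(t))$ for the monic Hermite polynomials $H_n(x)$. (1) $A(t)=1$, $R(t)=\frac{t^2}{4}$, $F(t)=e^{t}$, giving $$\sum_{n\ge0}\frac{1}{n!}H_n(x)t^n=e^{tx-\frac{t^2}{4}}.$$ (2) For complex parameters $\rho,\alpha_1$ such that all the numbers $\alpha_n=\frac{2^n}{n!}\big[H_n(\rho)+(\frac{\alpha_1}{2}-\rho)H_{n-1}(\rho,1)\big]$ are nonzero: $A(t)=\frac{1}{\sqrt{1-t^2}}$, $R(t)=\rho\Big(\frac{1}{\sqrt{1-t^2}}-1\Big)$, $$F(t)=\Big(1+\big(\tfrac{\alpha_1}{2}-\rho\big)\sqrt{\pi}\,e^{-\rho^2}\big[\mathrm{erfi}(\rho)-\mathrm{erfi}(\rho-t)\big]\Big)e^{t(2\rho-t)},$$ giving $$\sum_{n\ge0}\frac{2^n}{n!}\Big[H_n(\rho)+\big(\tfrac{\alpha_1}{2}-\rho\big)H_{n-1}(\rho,1)\Big]H_n(x)t^n=\frac{1}{\sqrt{1-t^2}}\Big(1+\big(\tfrac{\alpha_1}{2}-\rho\big)\sqrt{\pi}\,e^{-\rho^2}\Big[\mathrm{erfi}(\rho)-\mathrm{erfi}\Big(\frac{\rho-tx}{\sqrt{1-t^2}}\Big)\Big]\Big)e^{\frac{2x\rho t-(x^2+\rho^2)t^2}{1-t^2}}.$$ Conversely, these are the only ones: every generating function of the form $A(t)F(xtA(t)-R(t))$ of $\{H_n\}$ is, up to normalization, one of (1), (2).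
   Context: All power series are formal power series with complex coefficients (in $t$, with coefficients depending on $x$ where $x$ appears). A monic polynomial set (MPS) is a sequence $\{P_n(x)\}_{n\ge0}$ with $P_n(x)=x^n+$ lower degree terms. Generating function of the form $A(t)F(xtA(t)-R(t))$ for an MPS $\{P_n\}$: data $\big((\alpha_n)_{n\ge0},A,R,F\big)$ where $\alpha_n\in\mathbb C$, $\alpha_n\ne0$ for all $n$, $\alpha_0=1$, $F(t)=\sum_{n\ge0}\alpha_nt^n$, and $A,R$ are formal power series with $A(0)=1$, $R(0)=0$, such that $$A(t)F(xtA(t)-R(t))=\sum_{n\ge0}\alpha_nP_n(x)t^n$$ as formal power series in $t$ with coefficients in $\mathbb C[x]$. ''Up to normalization'' means up to the following operations, which preserve this property: (a) rescaling of $t$ by $c\in\mathbb C\setminus\{0\}$: $(\alpha_n,A(t),R(t),F(t))\mapsto(c^n\alpha_n,A(ct),c^{-1}R(ct),F(ct))$; (b) only when $A(t)=1$: replacing $F$ by $1+\kappa(F-1)$ with $\kappa\in\mathbb C\setminus\{0\}$ (so $\alpha_n\mapsto\kappa\alpha_n$ for $n\ge1$). The monic Hermite polynomials are $H_n(x)=x^n\,{}_2F_0\big(-\frac n2,-\frac{n-1}{2};-;-\frac1{x^2}\big)$; equivalently $H_{-1}=0$, $H_0=1$, $xH_n(x)=H_{n+1}(x)+\frac n2H_{n-1}(x)$. The associated monic Hermite polynomials $H_n(x,c)$ are defined by $H_{-1}(x,c)=0$, $H_0(x,c)=1$, $xH_n(x,c)=H_{n+1}(x,c)+\frac{n+c}{2}H_{n-1}(x,c)$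 for $n\ge0$. $\mathrm{erfi}(z)=\frac{2}{\sqrt\pi}\int_0^ze^{s^2}\,ds$. *)

(* Defs.v *)
From HB Require Import structures.
From Stdlib Require Import Relation_Operators.
From mathcomp Require Import all_boot all_order all_algebra.
From mathcomp Require Import all_classical all_reals all_analysis.
From mathcomp Require Import complex.

Set Implicit Arguments.
Unset Strict Implicit.
Unset Printing Implicit Defensive.

Import Order.TTheory GRing.Theory Num.Theory.
Import numFieldNormedType.Exports.

Local Open Scope classical_set_scope.
Local Open Scope ring_scope.
Local Open Scope complex_scope.

(* [a : fps K] stands for the formal power series [\sum_n a n t^n].
   The multiplication is the Cauchy product, not the pointwise product that
   [nat -> K] carries in MathComp-Analysis; [fps K] is a distinct key. *)
Definition fps (K : Type) : Type := nat -> K.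

Section FpsRing.
Variable K : comNzRingType.

HB.instance Definition _ := GRing.Zmodule.copy (fps K) (nat -> K).

Definition fpsC (c : K) : fps K := fun n => if n == 0%N then c else 0.

Definition fpsX : fps K := fun n => (n == 1%N)%:R.

Definition fps_mul (a b : fps K) : fps K :=
  fun n => \sum_(i < n.+1) a i * b (n - i)%N.

Lemma fps_mulE_rev a b n : fps_mul a b n = \sum_(i < n.+1) a (n - i)%N * b i.
Proof.
rewrite /fps_mul (reindex_inj rev_ord_inj) /=.
by apply: eq_bigr => i _; rewrite subSS subKn // -ltnS.
Qed.

Lemma fps_mulC : commutative fps_mul.
Proof.
move=> a b; apply/funext => n; rewrite fps_mulE_rev.
by apply: eq_bigr => i _; rewrite mulrC.
Qed.

Lemma fps_mulDl : left_distributive fps_mul +%R.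
Proof.
move=> a b c; apply/funext => n; rewrite /fps_mul.
rewrite [RHS]/GRing.add /= -big_split /=.
by apply: eq_bigr => i _; rewrite -mulrDl.
Qed.

Lemma fps_mul1 : left_id (fpsC 1) fps_mul.
Proof.
move=> a; apply/funext => n; rewrite /fps_mul big_ord_recl /= subn0 mul1r.
by rewrite big1 ?addr0 // => i _; rewrite mul0r.
Qed.

Lemma fps_mulA : associative fps_mul.
Proof.
move=> a b c; apply/funext => n.
pose coef3 i j := a i * (b (n - i - j)%N * c j).
transitivity (\sum_(i < n.+1) \sum_(j < n.+1 | (j <= n - i)%N) coef3 i j).
  apply: eq_bigr => /= i _; rewrite fps_mulE_rev big_distrr /=.
  by rewrite (big_ord_narrow_leq (leq_subr _ _)).
rewrite fps_mulE_rev (exchange_big_dep predT) //=; apply: eq_bigr => j _.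
transitivity (\sum_(i < n.+1 | (i <= n - j)%N) coef3 i j).
  apply: eq_bigl => i; rewrite -ltnS -(ltnS i) -!subSn //.
    by rewrite -subn_gt0 -(subn_gt0 i) -!subnDA addnC.
  by rewrite -ltnS ltn_ord.
  by rewrite -ltnS ltn_ord.
rewrite (big_ord_narrow_leq (leq_subr _ _)) big_distrl /=.
by apply: eq_bigr => i _; rewrite /coef3 mulrA -!subnDA addnC.
Qed.

Lemma fps_oner_neq0 : fpsC 1 != 0 :> fps K.
Proof.
by apply/eqP => /(congr1 (fun a : fps K => a 0%N)) /eqP; rewrite oner_eq0.
Qed.

HB.instance Definition _ := GRing.Zmodule_isComNzRing.Build (fps K)
  fps_mulA fps_mulC fps_mul1 fps_mulDl fps_oner_neq0.

(* F(G(t)), meaningful when G(0) = 0: the sum then loses nothing by stopping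
   at k = n. *)
Definition fps_comp (F G : fps K) : fps K :=
  fun n => \sum_(k < n.+1) F k * (G ^+ k) n.

(* f(G(t)) when G(0) = c and F is the Taylor series of f at c. *)
Definition fps_comp_at (c : K) (F G : fps K) : fps K :=
  fps_comp F (G - fpsC c).

(* a(ct) *)
Definition fps_dilate (c : K) (a : fps K) : fps K := fun n => c ^+ n * a n.

(* From C[[t]] to C[x][[t]]. *)
Definition fps_lift (a : fps K) : fps {poly K} := fun n => (a n)%:P.

End FpsRing.

Arguments fpsX {K}.

Section FpsField.
Variable K : numFieldType.

Definition fps_exp : fps K := fun n => (n`!)%:R^-1.

(* (1 + t)^a *)
Definition fps_binom (a : K) : fps K :=
  fun n => (\prod_(i < n) (a - i%:R)) / (n`!)%:R.

(* (1 - t^2)^a *)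
Definition fps_pow1mX2 (a : K) : fps K := fps_comp (fps_binom a) (- fpsX ^+ 2).

Definition fps_invsqrt1mX2 : fps K := fps_pow1mX2 (- 2^-1).

(* [derive1n] differentiates over the base field [K]: for K = R[i] this is the
   Taylor series of f at z in the complex sense. *)
Definition taylor (f : K -> K) (z : K) : fps K :=
  fun n => derive1n n f z / (n`!)%:R.

End FpsField.

Arguments fps_exp {K}.
Arguments fps_invsqrt1mX2 {K}.

Section GeneratingFunctions.
Variable K : fieldType.

Definition mps (P : nat -> {poly K}) : Prop :=
  forall n, P n \is monic /\ size (P n) = n.+1.

Record genfun : Type := Genfun {
  gf_alpha : nat -> K;
  gf_A : fps K;
  gf_R : fps K;
  gf_F : fps K
}.

(* A(t) F(x t A(t) - R(t)) in C[x][[t]] *)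
Definition genfun_series (D : genfun) : fps {poly K} :=
  fps_lift (gf_A D) *
  fps_comp (fps_lift (gf_F D))
           (fpsC 'X * fpsX * fps_lift (gf_A D) - fps_lift (gf_R D)).

Definition is_genfun (P : nat -> {poly K}) (D : genfun) : Prop :=
  [/\ mps P,
      (forall n, gf_alpha D n != 0) /\ gf_alpha D 0%N = 1,
      gf_F D = gf_alpha D,
      gf_A D 0%N = 1 /\ gf_R D 0%N = 0
    & genfun_series D = (fun n => gf_alpha D n *: P n)].

(* The normalizations: rescaling of t by c, and, when A(t) = 1, replacing F by
   1 + k (F - 1). *)
Definition gf_rescale (c : K) (D : genfun) : genfun :=
  Genfun (fun n => c ^+ n * gf_alpha D n)
         (fps_dilate c (gf_A D))
         (fpsC c^-1 * fps_dilate c (gf_R D))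
         (fps_dilate c (gf_F D)).

Definition gf_stretch (k : K) (D : genfun) : genfun :=
  Genfun (fun n => if n == 0%N then gf_alpha D n else k * gf_alpha D n)
         (gf_A D)
         (gf_R D)
         (1 + fpsC k * (gf_F D - 1)).

Inductive normalization_step : genfun -> genfun -> Prop :=
| StepRescale c D : c != 0 -> normalization_step D (gf_rescale c D)
| StepStretch k D : k != 0 -> gf_A D = 1 ->
    normalization_step D (gf_stretch k D).

(* Each step is undone by a step of the same kind, so this is symmetric. *)
Definition up_to_normalization : genfun -> genfun -> Prop :=
  clos_refl_trans genfun normalization_step.

End GeneratingFunctions.

Section Hermite.
Variable K : fieldType.

(* The pair (H_n(x,c), H_(n-1)(x,c)), starting from (H_0, H_(-1)) = (1, 0). *)
Fixpoint assoc_hermite_pair (c : K) (n : nat) : {poly K} * {poly K} :=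
  if n is m.+1 then
    let: (h, hm) := assoc_hermite_pair c m in
    ('X * h - ((m%:R + c) / 2) *: hm, h)
  else (1, 0).

Definition assoc_hermite (c : K) (n : nat) : {poly K} :=
  (assoc_hermite_pair c n).1.

(* H_(n-1)(x,c), including H_(-1)(x,c) = 0 *)
Definition assoc_hermite_pred (c : K) (n : nat) : {poly K} :=
  (assoc_hermite_pair c n).2.

(* For c = 0 the recurrence is that of the monic Hermite polynomials. *)
Definition hermite (n : nat) : {poly K} := assoc_hermite 0 n.

End Hermite.

Arguments hermite {K}.

Section Erfi.
Variable R : realType.

Definition cexp (z : R[i]) : R[i] :=
  (expR (complex.Re z) * cos (complex.Im z)) +i*
  (expR (complex.Re z) * sin (complex.Im z)).

Definition csqrtpi : R[i] := (Num.sqrt pi)%:C.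

Definition cintegral01 (f : R -> R[i]) : R[i] :=
  (\int[lebesgue_measure]_(u in `[0, 1]) complex.Re (f u)) +i*
  (\int[lebesgue_measure]_(u in `[0, 1]) complex.Im (f u)).

(* The integral of e^(s^2) from 0 to z is taken along the segment s = u z. *)
Definition erfi (z : R[i]) : R[i] :=
  2 / csqrtpi * cintegral01 (fun u => z * cexp ((u%:C * z) ^+ 2)).

End Erfi.

Section Families.
Variable R : realType.
Local Notation C := R[i].

Definition genfun1 : genfun C :=
  Genfun (fun n => (n`!)%:R^-1) 1 (fpsC 4^-1 * fpsX ^+ 2) fps_exp.

(* e^(t x - t^2 / 4) *)
Definition closed_form1 : fps {poly C} :=
  fps_comp (fps_lift fps_exp) (fpsX * fpsC 'X - fpsC (4^-1)%:P * fpsX ^+ 2).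

Definition alpha2 (rho a1 : C) (n : nat) : C :=
  2 ^+ n / (n`!)%:R *
  ((hermite n).[rho] + (a1 / 2 - rho) * (assoc_hermite_pred 1 n).[rho]).

(* F(t) = (1 + (a1/2 - rho) sqrt(pi) e^(-rho^2) [erfi(rho) - erfi(rho - t)])
          e^(t (2 rho - t)) *)
Definition genfun2 (rho a1 : C) : genfun C :=
  Genfun (alpha2 rho a1)
    fps_invsqrt1mX2
    (fpsC rho * (fps_invsqrt1mX2 - 1))
    ((1 + fpsC ((a1 / 2 - rho) * csqrtpi R * cexp (- rho ^+ 2)) *
          (fpsC (erfi rho) -
           fps_comp_at rho (taylor (@erfi R) rho) (fpsC rho - fpsX))) *
     fps_comp fps_exp (fpsX * (fpsC (2 * rho) - fpsX))).

(* (1 - t^2)^(-1/2) (1 + (a1/2 - rho) sqrt(pi) e^(-rho^2)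
       [erfi(rho) - erfi((rho - t x) / sqrt(1 - t^2))])
     e^((2 x rho t - (x^2 + rho^2) t^2) / (1 - t^2)) *)
Definition closed_form2 (rho a1 : C) : fps {poly C} :=
  let S := fps_lift fps_invsqrt1mX2 in
  S *
  (1 + fpsC ((a1 / 2 - rho) * csqrtpi R * cexp (- rho ^+ 2))%:P *
       (fpsC (erfi rho)%:P -
        fps_comp_at rho%:P (fps_lift (taylor (@erfi R) rho))
          ((fpsC rho%:P - fpsX * fpsC 'X) * S))) *
  fps_comp (fps_lift fps_exp)
    ((fpsC (2 * rho%:P * 'X) * fpsX - fpsC ('X ^+ 2 + (rho ^+ 2)%:P) * fpsX ^+ 2)
     * fps_lift (fps_pow1mX2 (- 1))).

End Families.

(* Main.v *)
Require Import Defs.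
From HB Require Import structures.
From Stdlib Require Import Relation_Operators.
From mathcomp Require Import all_boot all_order all_algebra.
From mathcomp Require Import all_classical all_reals all_analysis.
From mathcomp Require Import complex ring lra zify.
Import Order.TTheory GRing.Theory Num.Theory.
Import numFieldNormedType.Exports.
Local Open Scope ring_scope.

(** Write the coefficient of [x^k] in [A F(xtA - R)] as [t^k U_k(t)], with
    [U_k = A^(k+1) F^(k)(-R) / k!]. The identity
    [A F(xtA - R) = sum_n alpha_n H_n(x) t^n] then says that the coefficient of
    [t^j] in [U_k] is [alpha_(k+j)] times the coefficient of [x^k] in
    [H_(k+j)], for all [k] and [j] (genfun_seriesP), and everything becomes a
    question on power series in one variable.

    Existence (is_genfun_hermite). Suppose [(1 - 2a t^2) A' = 2a t A],
    [(1 - 2a t^2) R' = 2r t A] and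
    [n alpha_n = 4 (r alpha_(n-1) - a alpha_(n-2))] for [n >= 2]. The two
    differential equations give
    [(1 - 2a t^2) U_k' = 2 (k+1) t (a U_k - r U_(k+1))]. The Hermite
    side satisfies the same recurrence, because [H_n' = n H_(n-1)] and
    [n H_n - x H_n' = - n(n-1)/2 H_(n-2)]; and the initial values agree. With
    [a = 0], [r = 1/4], [A = 1], [R = t^2/4] this is the first family; with
    [a = 1/2], [r = rho/2], [A = (1 - t^2)^(-1/2)], [R = rho (A - 1)] it is the
    second one.

    The series [F] of the second family. Since [erfi' (z) = 2/sqrt(pi) e^(z^2)]
    in the complex sense (has_derive_erfi), the product
    [F = (1 + kappa [erfi(rho) - erfi(rho - t)]) e^(t(2 rho - t))] satisfies
    [F' = 2 (rho - t) F + alpha_1 - 2 rho]. On coefficients this is the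
    recurrence of the numbers alpha_n, which also follows from the
    recurrences of the Hermite polynomials and of their associated polynomials
    (erfi_family_coef). The closed forms are obtained by expanding
    compositions of power series.

    Rigidity (genfun_hermite_inj). The first coefficients [A_j], [R_j] in which
    two pairs [(A, R)] differ enter [U_k] at order [t^j] as
    [(k+1) (alpha_k A_j - alpha_(k+1) R_j)] (layer_top). Hence alpha determines
    [A] and [R], unless alpha is geometric; in that case [F = 1/(1 - bt)], so
    [U_1 = b U_0^2], which contradicts the values of [H_2] and [H_3]
    (hermite_not_geometric).

    Classification. Comparing with [A = 1], [R = 0] at orders 1 and 2 gives
    [A_1 = R_1 = 0] and the recurrence above with [a = A_2], [r = R_2]
    (hermite_genfun_rec). If [A_2 <> 0], a dilation makes [A_2 = 1/2], alpha is
    then the sequence of the second family for [rho = 2 R_2], and rigidity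
    yields [A] and [R]. If [A_2 = 0], then [R_2 <> 0], a dilation makes
    [R_2 = 1/4], and [alpha_n = alpha_1 / n!] for [n > 0]; rigidity gives
    [A = 1], so that [alpha_1] can be normalized to 1. *)

Set Implicit Arguments.
Unset Strict Implicit.
Unset Printing Implicit Defensive.

(** * Formal power series *)

Section FpsTheory.
Variable K : comNzRingType.
Implicit Types (a b c F G : fps K) (x : K) (n m k i j : nat).

Lemma fps_coefD a b n : (a + b) n = a n + b n. Proof. by []. Qed.
Lemma fps_coefN a n : (- a) n = - a n. Proof. by []. Qed.
Lemma fps_coefB a b n : (a - b) n = a n - b n. Proof. by []. Qed.
Lemma fps_coef1 n : (1 : fps K) n = (n == 0)%:R.
Proof. by rewrite /GRing.one /= /fpsC; case: eqP. Qed.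
Lemma fps_coefM a b n : (a * b) n = \sum_(i < n.+1) a i * b (n - i)%N.
Proof. by []. Qed.

Lemma fps_coefMn a m n : (a *+ m) n = a n *+ m.
Proof. by elim: m => // m IH; rewrite !mulrS fps_coefD IH. Qed.

Lemma fps_coef_sum (I : Type) (r : seq I) (P : pred I) (f : I -> fps K) n :
  (\sum_(i <- r | P i) f i) n = \sum_(i <- r | P i) f i n.
Proof. by elim/big_rec2: _ => // i y1 y2 _ <-. Qed.

Lemma fps_coefCM x a n : (fpsC x * a) n = x * a n.
Proof.
rewrite fps_coefM big_ord_recl subn0 big1 ?addr0 // => i _.
by rewrite /fpsC /= mul0r.
Qed.

Lemma fpsC_is_zmod_morphism : zmod_morphism (@fpsC K).
Proof.
move=> x y; apply/funext => n; rewrite fps_coefB /fpsC.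
by case: eqP => // _; rewrite subr0.
Qed.

Lemma fpsC_is_monoid_morphism : monoid_morphism (@fpsC K).
Proof.
split=> // x y; apply/funext => n; rewrite fps_coefCM /fpsC.
by case: eqP => // _; rewrite mulr0.
Qed.

HB.instance Definition _ :=
  GRing.isZmodMorphism.Build K (fps K) (@fpsC K) fpsC_is_zmod_morphism.
HB.instance Definition _ :=
  GRing.isMonoidMorphism.Build K (fps K) (@fpsC K) fpsC_is_monoid_morphism.

Lemma fps_coefXM a n : (fpsX * a) n = if n is m.+1 then a m else 0.
Proof.
rewrite fps_coefM; case: n => [|n]; first by rewrite big_ord1 /fpsX mul0r.
rewrite big_ord_recl /fpsX /= mul0r add0r big_ord_recl /= mul1r subSS subn0.
by rewrite big1 ?addr0 // => i _; rewrite mul0r.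
Qed.

Lemma fps_coefXnM a m n :
  (fpsX ^+ m * a) n = if (m <= n)%N then a (n - m)%N else 0.
Proof.
elim: m n => [|m IH] n; first by rewrite expr0 mul1r subn0.
by rewrite exprS -mulrA fps_coefXM; case: n => // n; rewrite IH.
Qed.

Lemma fps_coefM0 a b : (a * b) 0%N = a 0%N * b 0%N.
Proof. by rewrite fps_coefM big_ord1. Qed.

Lemma fps_coefX0 a n : (a ^+ n) 0%N = a 0%N ^+ n.
Proof. by elim: n => // n IH; rewrite !exprS fps_coefM0 IH. Qed.

(** Congruence modulo [t^n]. *)
Definition fps_agree n a b := forall i, (i < n)%N -> a i = b i.

Lemma fps_agreeD n a a' b b' :
  fps_agree n a a' -> fps_agree n b b' -> fps_agree n (a + b) (a' + b').
Proof. by move=> aa' bb' i lin; rewrite !fps_coefD aa' ?bb'. Qed.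

Lemma fps_agreeM n a a' b b' :
  fps_agree n a a' -> fps_agree n b b' -> fps_agree n (a * b) (a' * b').
Proof.
move=> aa' bb' i lin; rewrite !fps_coefM; apply: eq_bigr => j _.
rewrite aa' ?bb' //; first exact: leq_ltn_trans (leq_subr _ _) lin.
by rewrite (leq_ltn_trans _ lin) // -ltnS.
Qed.

(** In the coefficient of [t^n] of a product, a coefficient of order [n] of one
    factor only meets the constant term of the other. *)
Lemma fps_coefM_top n a a' b b' : (0 < n)%N ->
    fps_agree n a a' -> fps_agree n b b' ->
  (a * b) n - (a' * b') n = (a n - a' n) * b 0%N + a 0%N * (b n - b' n).
Proof.
case: n => // n _ aa' bb'; rewrite !fps_coefM.
rewrite big_ord_recl big_ord_recr [X in _ - X]big_ord_recl.
rewrite [X in _ - (_ + X)]big_ord_recr /=.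
rewrite subn0 /bump /= !add1n !subnn -(aa' 0%N) // -(bb' 0%N) //.
rewrite (eq_bigr (fun i : 'I_n => a' i.+1 * b' (n.+1 - i.+1)%N)).
  by ring.
move=> i _; rewrite /bump /= ?add1n aa' ?ltnS // bb' //.
by rewrite subSS ltnS leq_subr.
Qed.

Lemma fps_valX G k n : G 0%N = 0 -> (n < k)%N -> (G ^+ k) n = 0.
Proof.
move=> G0; elim: k n => // k IH n lnk; rewrite exprS fps_coefM.
apply: big1 => -[[|i] /= lin] _; first by rewrite G0 mul0r.
by rewrite IH ?mulr0 // (leq_trans _ (_ : n <= k)%N) // ltn_subrL /=; case: n lin {lnk}.
Qed.

(** The truncation of the composition at [k = n] is immaterial, because [G^k]
    has no term below [t^k]. *)
Lemma fps_compE N F G n : G 0%N = 0 -> (n < N)%N ->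
  fps_comp F G n = \sum_(k < N) F k * (G ^+ k) n.
Proof.
move=> G0 lnN; rewrite /fps_comp.
rewrite (big_ord_widen N (fun k => F k * (G ^+ k) n)) //.
rewrite [RHS](bigID (fun k : 'I_N => (k < n.+1)%N)) /= [X in _ + X]big1 ?addr0 //.
by move=> i; rewrite -leqNgt => lni; rewrite fps_valX // mulr0.
Qed.

Lemma fps_comp0 F G : fps_comp F G 0%N = F 0%N.
Proof. by rewrite /fps_comp big_ord1 expr0 fps_coef1 mulr1. Qed.

(** By fps_compE, one truncation serves for all the coefficients of the
    composition that enter the product. *)
Lemma fps_coefM_comp a F G n : G 0%N = 0 ->
  (a * fps_comp F G) n = \sum_(k < n.+1) F k * (a * G ^+ k) n.
Proof.
move=> G0; rewrite fps_coefM.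
under eq_bigr => i _.
  rewrite (@fps_compE n.+1) // ?ltnS ?leq_subr // big_distrr /=.
  over.
rewrite exchange_big /=; apply: eq_bigr => k _; rewrite fps_coefM big_distrr /=.
by apply: eq_bigr => i _; rewrite mulrCA.
Qed.

Lemma fps_compD F F' G : fps_comp (F + F') G = fps_comp F G + fps_comp F' G.
Proof.
apply/funext => n; rewrite fps_coefD /fps_comp -big_split /=.
by apply: eq_bigr => i _; rewrite -mulrDl.
Qed.

Lemma fps_compN F G : fps_comp (- F) G = - fps_comp F G.
Proof.
apply/funext => n; rewrite fps_coefN /fps_comp -sumrN.
by apply: eq_bigr => i _; rewrite -mulNr.
Qed.

Lemma fps_compCM x F G : fps_comp (fpsC x * F) G = fpsC x * fps_comp F G.
Proof.
apply/funext => n; rewrite fps_coefCM /fps_comp big_distrr /=.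
by apply: eq_bigr => i _; rewrite mulrA fps_coefCM.
Qed.

Lemma fps_compC x G : fps_comp (fpsC x) G = fpsC x.
Proof.
apply/funext => n; rewrite /fps_comp big_ord_recl big1 => [|i _].
  by rewrite expr0 fps_coef1 /fpsC /= addr0; case: eqP; rewrite ?mulr1 ?mulr0.
by rewrite mul0r.
Qed.

Lemma fps_compX G : G 0%N = 0 -> fps_comp fpsX G = G.
Proof.
move=> G0; apply/funext => n.
rewrite (@fps_compE n.+2) // big_ord_recl /fpsX /= mul0r add0r.
by rewrite big_ord_recl /= mul1r big1 ?addr0 // => i _; rewrite mul0r.
Qed.

(** ** The derivation [d/dt] *)

Definition fps_deriv a : fps K := fun n => a n.+1 *+ n.+1.

Lemma fps_derivD a b : fps_deriv (a + b) = fps_deriv a + fps_deriv b.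
Proof. by apply/funext => n; rewrite /fps_deriv fps_coefD mulrnDl. Qed.

Lemma fps_derivN a : fps_deriv (- a) = - fps_deriv a.
Proof. by apply/funext => n; rewrite /fps_deriv fps_coefN mulNrn. Qed.

Lemma fps_derivB a b : fps_deriv (a - b) = fps_deriv a - fps_deriv b.
Proof. by rewrite fps_derivD fps_derivN. Qed.

Lemma fps_derivC x : fps_deriv (fpsC x) = 0.
Proof. by apply/funext => n; rewrite /fps_deriv /fpsC mul0rn. Qed.

Lemma fps_deriv1 : fps_deriv 1 = 0.
Proof. by rewrite -(fps_derivC 1). Qed.

Lemma fps_derivX : fps_deriv fpsX = 1.
Proof. by apply/funext => -[|n]; rewrite fps_coef1 /fps_deriv /fpsX //= mul0rn. Qed.

Lemma fps_derivM a b :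
  fps_deriv (a * b) = fps_deriv a * b + a * fps_deriv b.
Proof.
apply/funext => n; rewrite fps_coefD /fps_deriv [(a * b) _]fps_coefM.
rewrite -sumrMnl.
transitivity (\sum_(i < n.+2) (a i * b (n.+1 - i)%N *+ i +
                               a i * b (n.+1 - i)%N *+ (n.+1 - i))).
  by apply: eq_bigr => i _; rewrite -mulrnDr subnKC // -ltnS.
rewrite big_split /=; congr (_ + _).
  rewrite big_ord_recl mulr0n add0r fps_coefM; apply: eq_bigr => i _.
  by rewrite /bump /= ?add1n subSS mulrnAl.
rewrite big_ord_recr /= subnn mulr0n addr0 fps_coefM; apply: eq_bigr => i _.
by rewrite mulrnAr subSn // -ltnS.
Qed.

Lemma fps_derivCM x a : fps_deriv (fpsC x * a) = fpsC x * fps_deriv a.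
Proof. by rewrite fps_derivM fps_derivC mul0r add0r. Qed.

Lemma fps_derivXn a n : fps_deriv (a ^+ n.+1) = n.+1%:R * a ^+ n * fps_deriv a.
Proof.
elim: n => [|n IH]; first by rewrite expr0 expr1 mulr1 mul1r.
by rewrite exprS fps_derivM IH [a ^+ n.+1]exprS -!natr1; ring.
Qed.

Lemma fps_deriv_comp F G : G 0%N = 0 ->
  fps_deriv (fps_comp F G) = fps_comp (fps_deriv F) G * fps_deriv G.
Proof.
move=> G0; apply/funext => n; rewrite mulrC fps_coefM_comp //.
rewrite /fps_deriv /fps_comp -sumrMnl big_ord_recl expr0 fps_coef1.
rewrite /= mulr0 mul0rn add0r; apply: eq_bigr => i _.
rewrite /bump /= ?add1n -mulrnAr mulrnAl -mulrnAr; congr (_ * _).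
rewrite -[LHS]/(fps_deriv (G ^+ i.+1) n) fps_derivXn -mulrA mulr_natl fps_coefMn.
by rewrite mulrC.
Qed.

(** ** The dilation [a(t) -> a(ct)] *)

Lemma fps_dilateM x a b :
  fps_dilate x (a * b) = fps_dilate x a * fps_dilate x b.
Proof.
apply/funext => n; rewrite /fps_dilate !fps_coefM big_distrr /=.
apply: eq_bigr => i _; rewrite mulrACA -exprD subnKC //.
by rewrite -ltnS.
Qed.

Lemma fps_dilate1 x : fps_dilate x 1 = 1.
Proof.
apply/funext => n; rewrite /fps_dilate fps_coef1.
by case: eqP => [->|_]; rewrite ?mulr1 ?mulr0.
Qed.

Lemma fps_dilateXn x a n : fps_dilate x (a ^+ n) = fps_dilate x a ^+ n.
Proof.
by elim: n => [|n IH]; rewrite ?fps_dilate1 // !exprS fps_dilateM IH.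
Qed.

Lemma fps_dilateB x a b :
  fps_dilate x (a - b) = fps_dilate x a - fps_dilate x b.
Proof. by apply/funext => n; rewrite /fps_dilate !fps_coefB mulrBr. Qed.

Lemma fps_dilateC x y : fps_dilate x (fpsC y) = fpsC y.
Proof.
by apply/funext => n; rewrite /fps_dilate /fpsC; case: eqP => [->|_];
   rewrite ?mul1r ?mulr0.
Qed.

Lemma fps_dilateX x : fps_dilate x fpsX = fpsC x * fpsX.
Proof.
apply/funext => n; rewrite fps_coefCM /fps_dilate /fpsX.
by case: n => [|[|n]] /=; rewrite ?mulr0.
Qed.

Lemma fps_dilate_comp x F G :
  fps_dilate x (fps_comp F G) = fps_comp F (fps_dilate x G).
Proof.
apply/funext => n; rewrite {1}/fps_dilate /fps_comp big_distrr /=.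
by apply: eq_bigr => k _; rewrite -fps_dilateXn mulrCA.
Qed.

Lemma fps_comp_dilate x F G :
  fps_comp (fps_dilate x F) G = fps_comp F (fpsC x * G).
Proof.
apply/funext => n; rewrite /fps_comp; apply: eq_bigr => k _.
by rewrite exprMn -rmorphXn fps_coefCM /fps_dilate mulrCA mulrA.
Qed.

End FpsTheory.

Section FpsLift.
Variable K : comNzRingType.
Implicit Types (a b F G : fps K).

Lemma fps_lift_is_zmod_morphism : zmod_morphism (@fps_lift K).
Proof. by move=> a b; apply/funext => n; rewrite fps_coefB /fps_lift polyCB. Qed.

Lemma fps_lift_is_monoid_morphism : monoid_morphism (@fps_lift K).
Proof.
split=> [|a b]; apply/funext => n.
  by rewrite /fps_lift !fps_coef1; case: eqP.
rewrite /fps_lift !fps_coefM rmorph_sum; apply: eq_bigr => i _.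
exact: polyCM.
Qed.

HB.instance Definition _ := GRing.isZmodMorphism.Build
  (fps K) (fps {poly K}) (@fps_lift K) fps_lift_is_zmod_morphism.
HB.instance Definition _ := GRing.isMonoidMorphism.Build
  (fps K) (fps {poly K}) (@fps_lift K) fps_lift_is_monoid_morphism.

Lemma fps_liftC (x : K) : fps_lift (fpsC x) = fpsC x%:P.
Proof. by apply/funext => n; rewrite /fps_lift /fpsC; case: eqP. Qed.

Lemma fps_liftX : fps_lift (fpsX : fps K) = fpsX.
Proof. by apply/funext => n; rewrite /fps_lift /fpsX; case: eqP. Qed.

Lemma fps_lift_comp F G :
  fps_lift (fps_comp F G) = fps_comp (fps_lift F) (fps_lift G).
Proof.
apply/funext => n; rewrite /fps_comp {1}/fps_lift rmorph_sum.
by apply: eq_bigr => k _; rewrite -rmorphXn; apply: polyCM.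
Qed.

Lemma fps_lift_dilate (x : K) a :
  fps_lift (fps_dilate x a) = fps_dilate x%:P (fps_lift a).
Proof. by apply/funext => n; rewrite /fps_lift /fps_dilate polyCM rmorphXn. Qed.

End FpsLift.

Section FpsChar0.
Variable K : idomainType.
Hypothesis charK : [pchar K] =i pred0.
Implicit Types (a b F G H : fps K).

Lemma mulrSn_inj (n : nat) : injective (fun x : K => x *+ n.+1).
Proof.
move=> x y /= /eqP; rewrite -subr_eq0 -mulrnBl -mulr_natr mulf_eq0.
by rewrite ((pcharf0P _).1 charK) orbF subr_eq0 => /eqP.
Qed.

(** In characteristic 0, a congruence can be integrated, and gains one order. *)
Lemma fps_agree_deriv n a b : a 0%N = b 0%N ->
  fps_agree n (fps_deriv a) (fps_deriv b) -> fps_agree n.+1 a b.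
Proof. by move=> ab0 ab [|i] // lin; apply: mulrSn_inj (ab i lin). Qed.

Lemma fps_eq_agree a b : (forall n, fps_agree n a b) -> a = b.
Proof. by move=> ab; apply/funext => n; apply: (ab n.+1). Qed.

Lemma fps_eq_deriv a b : a 0%N = b 0%N -> fps_deriv a = fps_deriv b -> a = b.
Proof.
by move=> ab0 ab; apply: fps_eq_agree => -[|n] //; apply: fps_agree_deriv; rewrite ?ab.
Qed.

(** Both sides have the same constant term, and by the chain rule and the
    Leibniz rule their derivatives modulo [t^n] only involve instances of the
    identity modulo [t^n]. The same induction gives associativity. *)
Lemma fps_compM F F' G : G 0%N = 0 ->
  fps_comp (F * F') G = fps_comp F G * fps_comp F' G.
Proof.
move=> G0; apply: fps_eq_agree => n; elim: n => // n IH in F F' *.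
apply: fps_agree_deriv; first by rewrite fps_coefM0 !fps_comp0 fps_coefM0.
rewrite fps_derivM !fps_deriv_comp // fps_derivM fps_compD.
rewrite mulrA [_ * _ * fps_comp F' G]mulrAC -mulrDl.
by apply: fps_agreeM => //; apply: fps_agreeD; apply: IH.
Qed.

Lemma fps_compA F G H : G 0%N = 0 -> H 0%N = 0 ->
  fps_comp (fps_comp F G) H = fps_comp F (fps_comp G H).
Proof.
move=> G0 H0; have GH0 : fps_comp G H 0%N = 0 by rewrite fps_comp0.
apply: fps_eq_agree => n; elim: n => // n IH in F *.
apply: fps_agree_deriv; first by rewrite !fps_comp0.
rewrite !fps_deriv_comp // fps_compM // -mulrA.
by apply: fps_agreeM => //; apply: IH.
Qed.

End FpsChar0.

(** * Coefficients of a generating function in x *)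

Section Layers.
Variable K : fieldType.
Implicit Types (A R F : fps K) (D : genfun K).

(** The divided derivative [F^(k) / k!]. *)
Definition fps_hasse k F : fps K := fun s => F (k + s)%N *+ 'C(k + s, k).

Lemma fps_deriv_hasse k F :
  fps_deriv (fps_hasse k F) = fpsC k.+1%:R * fps_hasse k.+1 F.
Proof.
apply/funext => s; rewrite fps_coefCM /fps_deriv /fps_hasse -mulrnA mulr_natl.
rewrite -mulrnA addSnnS; congr (_ *+ _).
by rewrite [RHS]mulnC mul_bin_left addKn mulnC.
Qed.

(** The series [U_k] of the introduction. *)
Definition layer A R F k : fps K := A ^+ k.+1 * fps_comp (fps_hasse k F) (- R).

Lemma layer0 A R F k : A 0%N = 1 -> layer A R F k 0%N = F k.
Proof.
move=> A0; rewrite /layer fps_coefM0 fps_coefX0 A0 expr1n mul1r fps_comp0.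
by rewrite /fps_hasse addn0 binn.
Qed.

Lemma coef_genfun_term A R m n k :
  ((fps_lift A * (fpsC 'X * fpsX * fps_lift A - fps_lift R) ^+ m) n)`_k =
  if (k <= m)%N && (k <= n)%N
  then (A ^+ k.+1 * (- R) ^+ (m - k)) (n - k)%N *+ 'C(m, k) else 0.
Proof.
pose T i := (A ^+ i.+1 * (- R) ^+ (m - i)).
have termE (i : 'I_m.+1) :
    fps_lift A * ((- fps_lift R) ^+ (m - i) *
      (fpsC 'X * fpsX * fps_lift A) ^+ i *+ 'C(m, i)) =
    fpsC 'X^i * fps_lift (fpsX ^+ i * (T i *+ 'C(m, i))).
  rewrite /T !rmorphM rmorphMn rmorphM !rmorphXn rmorphN /= fps_liftX.
  by rewrite -mulr_natr -[X in _ = _ * (_ * X)]mulr_natr exprS !exprMn; ring.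
rewrite [X in X ^+ m]addrC exprDn big_distrr fps_coef_sum coef_sum /=.
under eq_bigr => i _.
  rewrite termE fps_coefCM mulrC mul_polyC coefZ coefXn fps_coefXnM.
  over.
have [lkm|] := leqP k m; last first.
  move=> lmk; apply: big1 => i _; case: eqP => [ki|]; rewrite ?mulr0 //.
  by move: (ltn_ord i); rewrite -ki ltnS leqNgt lmk.
rewrite (bigD1 (Ordinal (lkm : (k < m.+1)%N))) //= eqxx mulr1 big1 ?addr0.
  by case: ifP => // _; rewrite fps_coefMn.
move=> i /eqP ik; case: eqP => [ki|]; last by rewrite mulr0.
by case: ik; apply: val_inj.
Qed.

(** Taylor's formula at [-R], that is the binomial theorem for each power of
    [xtA - R], separates the powers of [x]: the one of exponent [k] comes with
    [t^k A^(k+1) F^(k)(-R) / k!]. *)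
Lemma coef_genfun_series D n k : gf_R D 0%N = 0 ->
  (genfun_series D n)`_k =
  if (k <= n)%N then layer (gf_A D) (gf_R D) (gf_F D) k (n - k)%N else 0.
Proof.
move=> R0; rewrite /genfun_series fps_coefM_comp; last first.
  rewrite fps_coefB !fps_coefM0 /fpsX /= mulr0 mul0r sub0r.
  by rewrite /fps_lift R0 oppr0.
rewrite coef_sum; under eq_bigr do rewrite coefCM coef_genfun_term.
have [lkn|lnk] := leqP k n; last first.
  by apply: big1 => i _; rewrite andbF mulr0.
rewrite -(subnKC lkn); set j := (n - k)%N; rewrite addKn /layer.
rewrite fps_coefM_comp ?fps_coefN ?R0 ?oppr0 // -addnS big_split_ord /=.
rewrite big1 ?add0r => [|i _]; last by rewrite leqNgt ltn_ord mulr0.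
by apply: eq_bigr => i _; rewrite leq_addr addKn /= mulrnAr mulrnAl.
Qed.

(** Differentiating [A^(k+1) F_k(-R)] yields the factors [A'] and [R'] and, from
    [F_k' = (k+1) F_(k+1)], the next series [layer]. *)
Lemma layer_ode A R F k (p q : K) : R 0%N = 0 ->
    (1 - fpsC p * fpsX ^+ 2) * fps_deriv A = fpsC p * fpsX * A ->
    (1 - fpsC p * fpsX ^+ 2) * fps_deriv R = fpsC q * fpsX * A ->
  (1 - fpsC p * fpsX ^+ 2) * fps_deriv (layer A R F k) =
  fpsC k.+1%:R * fpsX *
  (fpsC p * layer A R F k - fpsC q * layer A R F k.+1).
Proof.
move=> R0 odeA odeR; rewrite /layer fps_derivM fps_derivXn.
rewrite fps_deriv_comp ?fps_coefN ?R0 ?oppr0 // fps_deriv_hasse fps_compCM.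
rewrite fps_derivN (rmorph_nat (@fpsC K)).
set C0 := fps_comp _ _; set C1 := fps_comp _ _.
transitivity (k.+1%:R * A ^+ k * C0 * ((1 - fpsC p * fpsX ^+ 2) * fps_deriv A)
   - k.+1%:R * A ^+ k.+1 * C1 * ((1 - fpsC p * fpsX ^+ 2) * fps_deriv R)).
  by ring.
by rewrite odeA odeR !exprS; ring.
Qed.

Lemma layer_rec A R F k (p q : K) : R 0%N = 0 ->
    (1 - fpsC p * fpsX ^+ 2) * fps_deriv A = fpsC p * fpsX * A ->
    (1 - fpsC p * fpsX ^+ 2) * fps_deriv R = fpsC q * fpsX * A ->
  layer A R F k 1%N = 0 /\
  (forall j, layer A R F k j.+2 *+ j.+2 =
    p * layer A R F k j *+ (k.+1 + j) - q * layer A R F k.+1 j *+ k.+1).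
Proof.
move=> R0 odeA odeR; have := layer_ode F k R0 odeA odeR.
set U := layer A R F k; set V := layer A R F k.+1 => ode; split=> [|j].
  have := congr1 (fun a : fps K => a 0%N) ode.
  by rewrite -mulrA fps_coefCM fps_coefXM mulr0 mulrBl mul1r fps_coefB
    -mulrA fps_coefCM fps_coefXnM /= mulr0 subr0.
have := congr1 (fun a : fps K => a j.+1) ode.
rewrite -mulrA fps_coefCM fps_coefXM mulrBl mul1r !fps_coefB -mulrA !fps_coefCM.
rewrite fps_coefXnM {1}/fps_deriv => /(canRL (subrK _)) ->.
have -> : (if (1 < j.+1)%N then fps_deriv U (j.+1 - 2)%N else 0) = U j *+ j.
  by case: j => // j; rewrite /fps_deriv subSS subn1.
by rewrite mulrBr !mulr_natl mulrnAr mulrnDr addrAC.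
Qed.

End Layers.

(** * Hermite polynomials *)

Section HermiteFacts.
Variable K : numFieldType.
Local Notation H := (@hermite K).

Lemma assoc_hermite_pairS (c : K) n :
  assoc_hermite_pair c n.+1 =
  ('X * (assoc_hermite_pair c n).1
     - ((n%:R + c) / 2) *: (assoc_hermite_pair c n).2,
   (assoc_hermite_pair c n).1).
Proof. by rewrite /=; case: assoc_hermite_pair. Qed.

Lemma hermite0 : H 0 = 1. Proof. by []. Qed.
Lemma hermite1 : H 1 = 'X.
Proof. by rewrite /hermite /assoc_hermite /= mulr1 scaler0 subr0. Qed.

Lemma hermiteSS n : H n.+2 = 'X * H n.+1 - (n.+1%:R / 2) *: H n.
Proof.
by rewrite /hermite /assoc_hermite !assoc_hermite_pairS /= !addr0.
Qed.

Lemma deriv_hermite n : (H n.+1)^`() = n.+1%:R *: H n.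
Proof.
elim/ltn_ind: n => -[|[|n]] IH.
- by rewrite hermite1 derivX hermite0 scale1r.
- rewrite hermiteSS derivB derivM derivX mul1r derivZ hermite0 hermite1 derivX.
  by rewrite -polyC1 derivC scaler0 subr0 mulr1 scaler_nat mulr2n.
rewrite hermiteSS derivB derivM derivX mul1r derivZ !IH //.
rewrite [in RHS]hermiteSS [in LHS]hermiteSS -!mul_polyC -!natr1.
by rewrite !rmorphM !rmorphD; ring.
Qed.

Lemma coef_hermite_deriv n k :
  (H n.+1)`_k.+1 *+ k.+1 = (H n)`_k *+ n.+1.
Proof. by rewrite -coef_deriv deriv_hermite coefZ mulr_natl. Qed.

(** From the recurrence and [H_n' = n H_(n-1)], that is Euler's operator
    [n - x d/dx] sends [H_n] to [- n (n-1)/2 H_(n-2)]. *)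
Lemma coef_hermite_euler k j :
  (H (k + j).+2)`_k *+ j.+2 =
  - ((H (k + j))`_k * ((k + j).+2%:R * (k + j).+1%:R / 2)).
Proof.
set n := (k + j)%N.
have eul : H n.+2 *+ n.+2 - 'X * (H n.+2)^`() =
          - ((n.+2%:R * n.+1%:R / 2) *: H n).
  rewrite deriv_hermite hermiteSS -!mul_polyC -mulr_natl !rmorphM /=.
  by rewrite !rmorph_nat; ring.
have := congr1 (fun q : {poly K} => q`_k) eul.
rewrite coefB coefMn coefXM coef_deriv coefN coefZ mulrC => <-.
case: k => [|k] /= in n eul *; first by rewrite subr0.
by rewrite -mulrnBr ?/n; [congr (_ *+ _); lia | lia].
Qed.

Lemma coef_hermite_sub n : (H n.+1)`_n = 0.
Proof.
elim: n => [|n IH]; first by rewrite hermite1 coefX.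
have := coef_hermite_deriv n.+1 n; rewrite IH mul0rn => /eqP.
by rewrite mulrn_eq0 => /eqP.
Qed.

Lemma hermite_monic_size n :
  (H n \is monic /\ size (H n) = n.+1) /\
  (H n.+1 \is monic /\ size (H n.+1) = n.+2).
Proof.
elim: n => [|n [IH0 IH1]].
  by rewrite hermite0 hermite1 monic1 monicX size_poly1 size_polyX.
split=> //; case: IH0 IH1 => m0 s0 [m1 s1]; rewrite hermiteSS.
have sX : size ('X * H n.+1) = n.+3.
  by rewrite size_monicM ?monicX ?monic_neq0 // size_polyX s1.
have lt : (size (- (n.+1%:R / 2 *: H n)) < size ('X * H n.+1)%R)%N.
  by rewrite size_polyN sX (leq_ltn_trans (size_scale_leq _ _)) ?s0.
by rewrite monicE lead_coefDl // size_polyDl // sX -monicE monicMl ?monicX.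
Qed.

Lemma mps_hermite : mps H.
Proof. by move=> n; case: (hermite_monic_size n). Qed.

Lemma coef_hermite_lead n : (H n)`_n = 1.
Proof.
by have [/monicP + s] := mps_hermite n; rewrite lead_coefE s.
Qed.

Lemma coef_hermite_gt n k : (n < k)%N -> (H n)`_k = 0.
Proof. by move=> lnk; rewrite nth_default // (mps_hermite n).2. Qed.

End HermiteFacts.

(** * Generating functions of the Hermite polynomials *)

Section HermiteGenfun.
Variable K : numFieldType.
Local Notation H := (@hermite K).
Implicit Types (A R F : fps K) (D : genfun K).

Lemma genfun_seriesP D : gf_R D 0%N = 0 ->
  genfun_series D = (fun n => gf_alpha D n *: H n) <->
  forall k j, layer (gf_A D) (gf_R D) (gf_F D) k j =
              gf_alpha D (k + j)%N * (H (k + j))`_k.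
Proof.
move=> R0; split=> [eqD k j|eqD].
  by rewrite -coefZ -[_ *: _]/((fun n => gf_alpha D n *: H n) (k + j)%N) -eqD
     coef_genfun_series // leq_addr addKn.
apply/funext => n; apply/polyP => k; rewrite coef_genfun_series // coefZ.
have [lkn|lnk] := leqP k n; first by rewrite eqD subnKC.
by rewrite coef_hermite_gt ?mulr0.
Qed.

(** Here [layer_rec], the differential equations read on coefficients, determines
    the coefficient of order [j + 2] from those of order [j]; the order 0 is the
    leading coefficient of [H_k] and the order 1 vanishes by parity of
    [H_(k+1)]. The recurrence of [al] is what makes the Hermite side satisfy
    [layer_rec]. *)
Lemma is_genfun_hermite (al : nat -> K) A R (a r : K) :
    (forall n, al n != 0) -> al 0%N = 1 -> A 0%N = 1 -> R 0%N = 0 ->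
    (1 - fpsC (2 * a) * fpsX ^+ 2) * fps_deriv A = fpsC (2 * a) * fpsX * A ->
    (1 - fpsC (2 * a) * fpsX ^+ 2) * fps_deriv R = fpsC (2 * r) * fpsX * A ->
    (forall n, al n.+2 *+ n.+2 = 4 * (r * al n.+1 - a * al n)) ->
  is_genfun H (Genfun al A R al).
Proof.
move=> al_neq0 al0 A0 R0 odeA odeR rec; split=> //; first exact: mps_hermite.
apply/genfun_seriesP => //= k j; elim/ltn_ind: j k => -[|[|j]] IH k.
- by rewrite layer0 // addn0 coef_hermite_lead mulr1.
- by rewrite (layer_rec al k R0 odeA odeR).1 addn1 coef_hermite_sub mulr0.
apply: (@mulrSn_inj K (@pchar_num K) j.+1) => /=.
rewrite (layer_rec al k R0 odeA odeR).2 !IH // -[RHS]mulrnAr.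
rewrite !addnS coef_hermite_euler addSn.
have dH := coef_hermite_deriv K (k + j) k; have rec_kj := rec (k + j)%N.
set n := (k + j)%N in dH rec_kj *; set h := (H n)`_k in dH *.
transitivity (2 * a * (al n * h) *+ n.+1 - 2 * r * al n.+1 * (h *+ n.+1)).
  by rewrite -dH -mulr_natr -[in RHS]mulr_natr -[(H _)`_k.+1 *+ _]mulr_natr; ring.
transitivity (- (h * n.+1%:R / 2 * (4 * (r * al n.+1 - a * al n)))).
  by rewrite -[h *+ _]mulr_natr -[_ *+ n.+1]mulr_natr; field.
by rewrite -rec_kj -mulr_natr; field.
Qed.

End HermiteGenfun.

(** * Rigidity: the coefficients alpha_n determine A and R *)

Section Rigidity.
Variable K : comNzRingType.
Implicit Types (A R F : fps K).

Lemma fps_agreeX n (a a' : fps K) m :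
  fps_agree n a a' -> fps_agree n (a ^+ m) (a' ^+ m).
Proof. by move=> aa'; elim: m => // m IH; rewrite !exprS; apply: fps_agreeM. Qed.

Lemma fps_agree_comp n F (G G' : fps K) :
  fps_agree n G G' -> fps_agree n (fps_comp F G) (fps_comp F G').
Proof.
move=> GG' i lin; rewrite /fps_comp; apply: eq_bigr => k _.
by rewrite (fps_agreeX k GG' lin).
Qed.

Lemma fps_coefX_top n m (a a' : fps K) : (0 < n)%N -> a 0%N = 1 ->
  fps_agree n a a' -> (a ^+ m) n - (a' ^+ m) n = (a n - a' n) *+ m.
Proof.
move=> n_gt0 a0 aa'; elim: m => [|m IH]; first by rewrite !expr0 subrr.
rewrite !exprS (fps_coefM_top n_gt0 aa' (fps_agreeX m aa')) IH a0 mul1r.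
by rewrite fps_coefX0 a0 expr1n mulr1 mulrS.
Qed.

Lemma fps_comp_top n F (G G' : fps K) : (0 < n)%N ->
    G 0%N = 0 -> fps_agree n G G' ->
  fps_comp F G n - fps_comp F G' n = F 1%N * (G n - G' n).
Proof.
case: n => // n _ G0 GG'; rewrite /fps_comp -sumrB !big_ord_recl big1.
  by rewrite /= !expr0 subrr add0r addr0 -mulrBr.
move=> i _; rewrite -mulrBr (_ : lift ord0 (lift ord0 i) = i.+2 :> nat) //.
rewrite (exprS G i.+1) (exprS G' i.+1).
rewrite (fps_coefM_top _ GG' (fps_agreeX _ GG')) //.
by rewrite fps_coefX0 G0 expr0n mulr0 mul0r addr0 mulr0.
Qed.

End Rigidity.

Section RigidityField.
Variable K : fieldType.
Implicit Types (A R F : fps K).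

(** Since [A(0) = 1] and [R(0) = 0], a perturbation of order [t^j] of [A] and
    [R] contributes modulo [t^(j+1)] only through its first-order effect,
    evaluated at [t = 0]. *)
Lemma layer_top A A' R R' F k j : (0 < j)%N -> A 0%N = 1 -> R 0%N = 0 ->
    fps_agree j A A' -> fps_agree j R R' ->
  layer A R F k j - layer A' R' F k j =
  (F k * (A j - A' j) - F k.+1 * (R j - R' j)) *+ k.+1.
Proof.
move=> j_gt0 A0 R0 AA' RR'.
have NR0 : (- R) 0%N = 0 by rewrite fps_coefN R0 oppr0.
have NRR' : fps_agree j (- R) (- R') by move=> i lij; rewrite !fps_coefN RR'.
rewrite /layer (fps_coefM_top j_gt0 (fps_agreeX _ AA') (fps_agree_comp _ NRR')).
rewrite fps_comp_top // fps_coefX_top // fps_coefX0 A0 expr1n mul1r fps_comp0.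
rewrite /fps_hasse addn0 binn addn1 binSn !fps_coefN.
by ring.
Qed.

Lemma layer_trivial F k j : (0 < j)%N -> layer 1 0 F k j = 0.
Proof.
case: j => // j _; rewrite /layer expr1n mul1r oppr0 /fps_comp.
apply: big1 => -[[|s] ?] _ /=; first by rewrite expr0 fps_coef1 mulr0.
by rewrite expr0n mulr0.
Qed.

End RigidityField.

Section Converse.
Variable K : numFieldType.
Local Notation H := (@hermite K).
Implicit Types (A R F : fps K) (D : genfun K).

Lemma coef_hermite_subsub k : (H k.+2)`_k = - (k.+2%:R * k.+1%:R / 4).
Proof.
apply: (mulrSn_inj (@pchar_num K) (n := 1)).
have := coef_hermite_euler K k 0; rewrite addn0 coef_hermite_lead mul1r /= => ->.
by field.
Qed.

Lemma layer_hermite D k j : is_genfun H D ->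
  layer (gf_A D) (gf_R D) (gf_alpha D) k j = gf_alpha D (k + j)%N * (H (k + j))`_k.
Proof.
move=> [_ _ FE [_ R0] serE].
by rewrite -[in LHS]FE ((genfun_seriesP R0).1 serE).
Qed.

(** If [F(t) = 1/(1 - bt)] then [F' = b F^2], so that the coefficients of
    [x^1] and [x^0] satisfy [U_1 = b U_0^2]. This contradicts
    [H_2 = x^2 - 1/2], [H_3 = x^3 - 3x/2]. *)
Lemma hermite_not_geometric D (b : K) : is_genfun H D ->
  ~ (forall n, gf_alpha D n.+1 = b * gf_alpha D n).
Proof.
move=> gD geo; have [_ [al_neq0 al0] FE [A0 R0] _] := gD.
set al := gf_alpha D in geo al_neq0 al0 FE.
have alE n : al n = b ^+ n.
  by elim: n => [|n IH]; rewrite ?expr0 // geo IH exprS.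
have hasse1 : fps_hasse 1 al = fpsC b * ((al : fps K) * al).
  apply/funext => s; rewrite fps_coefCM fps_coefM /fps_hasse bin1 !add1n alE.
  rewrite (eq_bigr (fun=> b ^+ s)) => [|i _].
    by rewrite sumr_const card_ord mulrnAr -exprS.
  by rewrite !alE -exprD subnKC // -ltnS.
have hasse0 : fps_hasse 0 al = al.
  by apply/funext => s; rewrite /fps_hasse bin0 add0n.
have NR0 : (- gf_R D) 0%N = 0 by rewrite fps_coefN R0 oppr0.
have U10 : layer (gf_A D) (gf_R D) al 1 = fpsC b *
    (layer (gf_A D) (gf_R D) al 0 * layer (gf_A D) (gf_R D) al 0).
  rewrite /layer hasse0 hasse1 fps_compCM fps_compM //; last exact: pchar_num.
  by ring.
have := congr1 (fun a : fps K => a 2%N) U10.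
rewrite fps_coefCM fps_coefM !big_ord_recr big_ord0 /= !layer_hermite //.
rewrite hermite0 hermite1 !coefX coefC /= -/al al0 !alE.
rewrite !coef_hermite_subsub => e.
have /eqP := al_neq0 3; apply; rewrite alE.
apply: (mulIf (_ : 2^-1 != 0 :> K)); first by rewrite invr_eq0 pnatr_eq0.
move/eqP: e; rewrite eq_sym -subr_eq0 subn0 add0n add0n => /eqP e.
by rewrite mul0r; apply: etrans e; field.
Qed.

(** Comparison with the pair [A = 1], [R = 0], whose series [layer] are constant.
    At order 1 the coefficient of [x^k] in [H_(k+1)] vanishes, so that
    [alpha_k A_1 = alpha_(k+1) R_1] and [R_1 <> 0] would make alpha geometric.
    At order 2 the coefficient [- (k+2)(k+1)/4] of [x^k] in [H_(k+2)] produces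
    the recurrence. *)
Lemma hermite_genfun_rec D : is_genfun H D ->
  [/\ gf_A D 1%N = 0, gf_R D 1%N = 0 &
      forall n, gf_alpha D n.+2 *+ n.+2 =
                4 * (gf_R D 2%N * gf_alpha D n.+1 - gf_A D 2%N * gf_alpha D n)].
Proof.
move=> gD; have [_ [al_neq0 al0] FE [A0 R0] _] := gD.
have topE j k : (0 < j)%N -> fps_agree j (gf_A D) 1 -> fps_agree j (gf_R D) 0 ->
    (gf_alpha D k * gf_A D j - gf_alpha D k.+1 * gf_R D j) *+ k.+1 =
    gf_alpha D (k + j)%N * (H (k + j))`_k.
  move=> j_gt0 agA agR; rewrite -layer_hermite //.
  have := layer_top (gf_alpha D) k j_gt0 A0 R0 agA agR.
  by rewrite layer_trivial // fps_coef1 gtn_eqF // !subr0.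
have lin k : gf_alpha D k * gf_A D 1%N = gf_alpha D k.+1 * gf_R D 1%N.
  apply/eqP; rewrite -subr_eq0; apply/eqP.
  apply: (mulrSn_inj (@pchar_num K) (n := k)); rewrite mul0rn topE //.
  - by rewrite addn1 coef_hermite_sub mulr0.
  - by case=> // _; rewrite A0.
  - by case=> // _; rewrite R0.
have R1 : gf_R D 1%N = 0.
  apply/eqP/negP => /negP R1; apply: (hermite_not_geometric gD) => n.
  by rewrite -[LHS](mulfK R1) -lin [_ * gf_A D 1]mulrC mulrAC.
have A1 : gf_A D 1%N = 0 by have := lin 0%N; rewrite R1 al0 mulr0 mul1r.
split=> // k; apply: (mulrSn_inj (@pchar_num K) (n := k)) => /=.
have agA : fps_agree 2 (gf_A D) 1 by case=> [|[]] // _; rewrite ?A0 ?A1.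
have agR : fps_agree 2 (gf_R D) 0 by case=> [|[]] // _; rewrite ?R0 ?R1.
have := topE 2 k isT agA agR; rewrite addn2 coef_hermite_subsub => e.
rewrite -mulrnAr mulrnBl.
transitivity (- 4 * (gf_alpha D k.+2 * - (k.+2%:R * k.+1%:R / 4))); first by field.
by rewrite -e; ring.
Qed.

(** If two generating functions first differ at order [j], then by layer_top the
    differences satisfy [alpha_k dA = alpha_(k+1) dR] for all [k]: either alpha
    is geometric, or both vanish. *)
Lemma genfun_hermite_inj D D' : is_genfun H D -> is_genfun H D' ->
  gf_alpha D = gf_alpha D' -> D = D'.
Proof.
move=> gD gD' alE; have [_ [al_neq0 al0] FE [A0 R0] _] := gD.
have [_ _ FE' [A0' R0'] _] := gD'.
suff AR j : fps_agree j (gf_A D) (gf_A D') /\ fps_agree j (gf_R D) (gf_R D').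
  have AE : gf_A D = gf_A D' by apply: fps_eq_agree => j; case: (AR j).
  have RE : gf_R D = gf_R D' by apply: fps_eq_agree => j; case: (AR j).
  case: D {gD al_neq0 al0 A0 R0 AR} alE FE AE RE => al A R F /=.
  by case: D' {gD' A0' R0'} FE' => al' A' R' F' /= -> -> -> -> ->.
elim: j => // j [agA agR]; case: j => [|j] in agA agR *.
  by split=> -[|//] _; rewrite ?A0 ?R0.
have lin k : gf_alpha D k * (gf_A D j.+1 - gf_A D' j.+1) =
             gf_alpha D k.+1 * (gf_R D j.+1 - gf_R D' j.+1).
  apply/eqP; rewrite -subr_eq0; apply/eqP.
  apply: (mulrSn_inj (@pchar_num K) (n := k)); rewrite mul0rn -layer_top //.
  by rewrite layer_hermite // alE layer_hermite // subrr.
have dR : gf_R D j.+1 - gf_R D' j.+1 = 0.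
  apply/eqP/negP => /negP dR; apply: (hermite_not_geometric gD) => n.
  by rewrite -[LHS](mulfK dR) -lin [_ * (_ - _)]mulrC mulrAC.
have dA : gf_A D j.+1 - gf_A D' j.+1 = 0.
  by have := lin 0%N; rewrite dR al0 mulr0 mul1r.
by split=> i; rewrite ltnS leq_eqVlt => /predU1P[->|]; auto;
   apply/eqP; rewrite -subr_eq0 ?dA ?dR.
Qed.

(** The generating function of the dilated data is obtained by substituting [ct]
    for [t]: the factor [c] in [F(ct)] compensates for the [1/c] in front of
    [R(ct)]. *)
Lemma is_genfun_rescale D (c : K) : c != 0 ->
  is_genfun H D -> is_genfun H (gf_rescale c D).
Proof.
move=> c_neq0 [mpsH [al_neq0 al0] FE [A0 R0] serE].
split=> //=.
- by split=> [n|]; rewrite ?mulf_neq0 ?expf_neq0 // al0 expr0 mul1r.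
- by rewrite FE.
- by rewrite fps_coefCM /fps_dilate A0 R0 !mulr0 expr0 mulr1.
have -> : genfun_series (gf_rescale c D) = fps_dilate c%:P (genfun_series D).
  rewrite /genfun_series /= !fps_lift_dilate fps_comp_dilate fps_dilateM.
  rewrite fps_dilate_comp fps_dilateB !fps_dilateM fps_dilateC fps_dilateX.
  have cV : fpsC c%:P * fpsC c^-1%:P = 1 :> fps {poly K}.
    by rewrite -rmorphM /= -polyCM mulfV.
  rewrite rmorphM /= fps_liftC fps_lift_dilate mulrBr.
  rewrite [fpsC _ * (fpsC c^-1%:P * _)]mulrA cV mul1r.
  by congr (_ * fps_comp _ (_ - _)); ring.
apply/funext => n; rewrite serE /fps_dilate -!mul_polyC polyCM rmorphXn /=.
by rewrite mulrA.
Qed.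

End Converse.

(** * Binomial series *)

Section Binomial.
Variable K : numFieldType.
Implicit Type a : K.

Lemma fps_binom_ode a :
  (1 + fpsX) * fps_deriv (fps_binom a) = fpsC a * fps_binom a.
Proof.
have step n : fps_binom a n.+1 *+ n.+1 = (a - n%:R) * fps_binom a n.
  rewrite /fps_binom big_ord_recr /= factS natrM -mulr_natr.
  field.
  by rewrite nat1r !pnatr_eq0 -lt0n fact_gt0.
apply/funext => n; rewrite mulrDl mul1r fps_coefD fps_coefXM fps_coefCM.
rewrite {1}/fps_deriv step; case: n => [|n]; first by rewrite subr0 addr0.
by rewrite -[fps_deriv _ n]/(fps_binom a n.+1 *+ n.+1) -mulr_natr; ring.
Qed.

Lemma negX2_0 : (- fpsX ^+ 2 : fps K) 0%N = 0.
Proof. by rewrite fps_coefN fps_coefX0 /fpsX /= expr0n oppr0. Qed.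

Lemma fps_pow1mX2_0 a : fps_pow1mX2 a 0%N = 1.
Proof. by rewrite /fps_pow1mX2 fps_comp0 /fps_binom big_ord0 divr1. Qed.

Lemma fps_invsqrt1mX2_0 : (@fps_invsqrt1mX2 K) 0%N = 1.
Proof. exact: fps_pow1mX2_0. Qed.

Lemma fps_pow1mX2_ode a :
  (1 - fpsX ^+ 2) * fps_deriv (fps_pow1mX2 a) =
  - (2 * fpsC a * fpsX * fps_pow1mX2 a).
Proof.
have := congr1 (fun F => fps_comp F (- fpsX ^+ 2)) (fps_binom_ode a).
rewrite fps_compM ?negX2_0 //; last exact: pchar_num.
rewrite fps_compD fps_compX ?negX2_0 // fps_compCM -[1]/(fpsC 1) fps_compC => ode.
rewrite /fps_pow1mX2 fps_deriv_comp ?negX2_0 // mulrA ode.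
by rewrite fps_derivN fps_derivXn fps_derivX; ring.
Qed.

Lemma fps_pow1mX2_N1 : (1 - fpsX ^+ 2) * fps_pow1mX2 (-1) = 1 :> fps K.
Proof.
apply: (fps_eq_deriv (@pchar_num K)).
  by rewrite fps_coefM0 fps_pow1mX2_0 fps_coefD negX2_0 addr0 mulr1.
rewrite fps_derivM fps_pow1mX2_ode fps_derivB fps_derivXn fps_derivX fps_deriv1.
by rewrite rmorphN1; ring.
Qed.

Lemma fps_invsqrt1mX2_ode : (1 - fpsX ^+ 2) * fps_deriv (@fps_invsqrt1mX2 K) =
  fpsX * fps_invsqrt1mX2.
Proof.
rewrite fps_pow1mX2_ode -(rmorph_nat (@fpsC K)) -!mulNr -rmorphN -rmorphM /=.
by rewrite mulNr mulrN mulfV ?pnatr_eq0 // opprK rmorph1 mul1r.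
Qed.

(** Both sides have constant term 1, and the derivative of the left-hand side
    vanishes by the differential equation. *)
Lemma fps_invsqrt1mX2_sqr :
  (1 - fpsX ^+ 2) * fps_invsqrt1mX2 ^+ 2 = 1 :> fps K.
Proof.
apply: (fps_eq_deriv (@pchar_num K)).
  rewrite fps_coefM0 fps_coefX0 fps_invsqrt1mX2_0 fps_coefD negX2_0 addr0.
  by rewrite expr1n mulr1.
rewrite fps_derivM fps_derivXn [(1 - _) * _]mulrCA fps_invsqrt1mX2_ode.
by rewrite fps_derivB fps_derivXn fps_derivX fps_deriv1; ring.
Qed.

End Binomial.

(** * The function erfi *)

Section DerivEps.
Variable K : numFieldType.

(** For [K = R[i]] this is complex differentiability. *)
Definition has_derive (f : K -> K) (z l : K) : Prop := is_derive z 1 f l.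

Lemma has_deriveP (f : K -> K) (z l : K) :
  has_derive f z l <->
  forall e, 0 < e -> exists2 d, 0 < d &
    forall h, `|h| < d -> `|f (h + z) - f z - l * h| <= e * `|h|.
Proof.
have cvgE : (h^-1 *: ((f \o shift z) (h *: 1) - f z) @[h --> 0^'] --> l)%classic <->
  forall e, 0 < e -> exists2 d, 0 < d &
    forall h, `|h| < d -> `|f (h + z) - f z - l * h| <= e * `|h|.
  have quot e h : h != 0 ->
      (`|l - h^-1 *: ((f \o shift z) (h *: 1) - f z)| <= e) =
      (`|f (h + z) - f z - l * h| <= e * `|h|).
    move=> h0; rewrite -(ler_pM2r (_ : 0 < `|h|)) ?normr_gt0 // -normrM.
    rewrite /= -[h *: 1]/(h * 1) mulr1 -[_ *: _]/(_ * _) mulrBl mulrAC mulVf //.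
    by rewrite mul1r distrC.
  split=> [/cvgrPdist_le fl e /fl|fl].
    rewrite -nbhs_nearE => /nbhs_ballP[d /= d0 dP]; exists d => // h hd.
    have [->|h0] := eqVneq h 0; first by rewrite add0r subrr mulr0 subr0 normr0 mulr0.
    by rewrite -quot //; apply: dP; rewrite // -ball_normE /= sub0r normrN.
  apply/cvgrPdist_le => e /fl[d d0 dP]; rewrite -nbhs_nearE.
  apply/nbhs_ballP; exists d => // h; rewrite -ball_normE /= sub0r normrN => hd h0.
  by rewrite quot //; apply: dP.
split=> [[df dl]|fl]; first by apply: cvgE.1; rewrite -dl.
by move: cvgE.2 => /(_ fl) {}fl; split; [apply: cvgP fl | apply: cvg_lim].
Qed.

End DerivEps.

Section ComplexExp.
Variable R : realType.
Local Open Scope complex_scope.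
Local Notation C := R[i].
Local Notation N := (@Normc.normc R).
Implicit Types (z w h v : C) (x y e d : R).

Lemma gt0_real_complex z : 0 < z -> exists2 x, 0 < x & z = x%:C.
Proof.
case: z => a b; rewrite ltcE /= => /andP[/eqP b0 a0]; exists a => //.
by rewrite b0.
Qed.

Lemma has_derive_normc (f : C -> C) z l :
  has_derive f z l <->
  forall e, 0 < e -> exists2 d, 0 < d &
    forall h, N h < d -> N (f (h + z) - f z - l * h) <= e * N h.
Proof.
have normE w : `|w| = (N w)%:C by [].
split=> [/has_deriveP fl e e0|fl]; last apply/has_deriveP.
  have [|d /gt0_real_complex[d' d0 ->] dP] := fl e%:C; first by rewrite ltcR.
  exists d' => // h; rewrite -ltcR -normE => /dP.
  by rewrite !normE -rmorphM lecR.
move=> e /gt0_real_complex[e' /fl[d d0 dP] ->].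
exists d%:C; first by rewrite ltcR.
move=> h; rewrite normE ltcR => /dP.
by rewrite !normE -rmorphM lecR.
Qed.

Lemma cexp0 : cexp 0 = 1 :> C.
Proof. by rewrite /cexp /= expR0 cos0 sin0 mul1r mulr0. Qed.

Lemma cexpD z w : cexp (z + w) = cexp z * cexp w.
Proof.
case: z w => [a b] [c d]; rewrite /cexp /= expRD cosD sinD.
by apply/eqP; rewrite eq_complex /=; apply/andP; split; apply/eqP; ring.
Qed.

Lemma normc_cexp z : N (cexp z) = expR (complex.Re z).
Proof.
rewrite /cexp /Normc.normc /= !exprMn -mulrDr cos2Dsin2 mulr1 sqrtr_sqr.
by rewrite ger0_norm ?expR_ge0.
Qed.

Lemma normc_ge0 z : 0 <= N z.
Proof. by case: z => a b; apply: sqrtr_ge0. Qed.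

Lemma normc_real x : N x%:C = `|x|.
Proof. by rewrite /Normc.normc /= expr0n addr0 sqrtr_sqr. Qed.

Lemma normc_im x : N (0 +i* x) = `|x|.
Proof. by rewrite /Normc.normc /= expr0n add0r sqrtr_sqr. Qed.

Lemma ler_normc_Re z : `|complex.Re z| <= N z.
Proof.
by case: z => a b; rewrite /Normc.normc /= -sqrtr_sqr ler_wsqrtr // lerDl sqr_ge0.
Qed.

Lemma ler_normc_Im z : `|complex.Im z| <= N z.
Proof.
by case: z => a b; rewrite /Normc.normc /= -sqrtr_sqr ler_wsqrtr // lerDr sqr_ge0.
Qed.

(** Splitting [exp(x + iy) - 1 - (x + iy)] as
    [(e^x - 1 - x) e^(iy) + (1 + x)(e^(iy) - 1 - iy) + ixy] reduces the complex
    derivative at the origin to real derivatives. *)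
Lemma cexp_near0 e : 0 < e -> exists2 d, 0 < d &
  forall v, N v < d -> N (cexp v - 1 - v) <= e * N v.
Proof.
move=> e_gt0.
have e8 : 0 < e / 8 by rewrite divr_gt0.
have [d1 d1_gt0 expP] := (has_deriveP _ _ _).1 (is_derive_expR (0 : R)) _ e8.
have [d2 d2_gt0 cosP] := (has_deriveP _ _ _).1 (is_derive_cos (0 : R)) _ e8.
have [d3 d3_gt0 sinP] := (has_deriveP _ _ _).1 (is_derive_sin (0 : R)) _ e8.
exists (Num.min (Num.min d1 d2) (Num.min d3 (Num.min 1 (e / 8)))).
  by rewrite !lt_min d1_gt0 d2_gt0 d3_gt0 e8 ltr01.
move=> v; rewrite !lt_min => /and4P[/andP[v1 v2] v3 v4 v5].
have xn := ler_normc_Re v; have yn := ler_normc_Im v.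
have n_ge0 : 0 <= N v by apply: le_trans xn.
move: (N v) v1 v2 v3 v4 v5 xn yn n_ge0 => n v1 v2 v3 v4 v5.
case: v => x y xn yn n_ge0; rewrite /= in xn yn.
have {}expP := expP x (le_lt_trans xn v1).
have {}cosP := cosP y (le_lt_trans yn v2).
have {}sinP := sinP y (le_lt_trans yn v3).
rewrite addr0 expR0 mul1r in expP.
rewrite addr0 cos0 sin0 oppr0 mul0r subr0 in cosP.
rewrite addr0 sin0 cos0 subr0 mul1r in sinP.
pose cis := (cos y +i* sin y : C).
have cis1 : N cis = 1 by rewrite /Normc.normc /= cos2Dsin2 sqrtr1.
have -> : cexp (x +i* y) - 1 - (x +i* y) =
    (expR x - 1 - x)%:C * cis + (1 + x)%:C * (cos y - 1)%:C
    + (1 + x)%:C * (0 +i* (sin y - y)) + x%:C * (0 +i* y).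
  by apply/eqP; rewrite eq_complex /=; apply/andP; split; apply/eqP; ring.
rewrite (le_trans (le_normcD _ _)) //.
rewrite (le_trans (lerD (le_normcD _ _) (lexx _))) //.
rewrite (le_trans (lerD (lerD (le_normcD _ _) (lexx _)) (lexx _))) //.
rewrite !Normc.normcM cis1 !normc_real !normc_im mulr1.
have x2 : `|1 + x| <= 2 by rewrite (le_trans (ler_normD _ _)) // normr1; lra.
have := normr_ge0 x; have := normr_ge0 y => y0 x0.
have := ler_pM (normr_ge0 _) (normr_ge0 _) x2 cosP.
have := ler_pM (normr_ge0 _) (normr_ge0 _) x2 sinP.
have := ler_pM (normr_ge0 _) (normr_ge0 _) (le_trans xn (ltW v5)) yn.
have : e / 8 * `|x| <= e / 8 * n by rewrite ler_pM2l.
have : e / 8 * `|y| <= e / 8 * n by rewrite ler_pM2l.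
have : 0 <= e / 8 * n by rewrite mulr_ge0 // ltW.
lra.
Qed.

End ComplexExp.

Section HasDerive.
Variable K : numFieldType.
Implicit Types (f g : K -> K) (z a b c : K).

Lemma has_derive1 f z a : has_derive f z a -> (f^`() z)%classic = a.
Proof. by move=> fa; rewrite derive1E; apply: derive_val. Qed.

Lemma has_derive_cst c z : has_derive (fun=> c) z 0.
Proof. exact: is_derive_cst. Qed.

Lemma has_derive_id z : has_derive (fun x => x) z 1.
Proof. exact: is_derive_id. Qed.

Lemma has_deriveM f g z a b : has_derive f z a -> has_derive g z b ->
  has_derive (fun x => f x * g x) z (a * g z + f z * b).
Proof.
move=> fa gb; apply: (is_derive_eq (is_deriveM fa gb)).
by rewrite addrC /GRing.scale /= [a * _]mulrC.
Qed.

Lemma has_deriveMl c f z a : has_derive f z a ->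
  has_derive (fun x => c * f x) z (c * a).
Proof.
by move=> fa; have := has_deriveM (has_derive_cst c z) fa; rewrite mul0r add0r.
Qed.

Lemma has_derive_sqr f z a : has_derive f z a ->
  has_derive (fun x => f x ^+ 2) z (2 * f z * a).
Proof.
by move=> fa; apply: (is_derive_eq (has_deriveM fa fa)); ring.
Qed.

Lemma has_derive_comp f g z a b : has_derive f (g z) a -> has_derive g z b ->
  has_derive (fun x => f (g x)) z (a * b).
Proof.
move=> [/derivable1_diffP df <-] [/derivable1_diffP dg <-].
have dfg : differentiable (f \o g) z by exact: differentiable_comp.
split; first exact/derivable1_diffP.
rewrite -!derive1E (derive1E' df) (derive1E' dg).
rewrite -[LHS]/((f \o g)^`()%classic z) (derive1E' dfg).
apply: (etrans (congr1 (@^~ (1 : K)) (diff_comp dg df))); rewrite [LHS]/=.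
by rewrite -[X in 'd _ _ X = _]mulr1 [LHS]linearZ mulrC.
Qed.

Lemma has_derive_horner (p : {poly K}) z : has_derive (horner p) z (p^`()).[z].
Proof.
elim/poly_ind: p => [|p c IH].
  have -> : horner 0 = (fun=> 0 : K) by apply/funext => x; rewrite horner0.
  by rewrite deriv0 horner0; apply: has_derive_cst.
have -> : horner (p * 'X + c%:P) = (fun x => p.[x] * x + c).
  by apply/funext => x; rewrite hornerMXaddC.
apply: (is_derive_eq
  (is_deriveD (has_deriveM IH (has_derive_id z)) (has_derive_cst c z))).
by rewrite derivD derivM derivX derivC !hornerE.
Qed.

End HasDerive.

Section ErfiDerive.
Variable R : realType.
Local Open Scope complex_scope.
Local Notation C := R[i].
Local Notation N := (@Normc.normc R).
Local Notation mu := (@lebesgue_measure R).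
Implicit Types (z w h v : C) (x y e d : R).

(** By [e^(h+z) = e^z e^h], the origin is enough. *)
Lemma has_derive_cexp z : has_derive (@cexp R) z (cexp z).
Proof.
apply/has_derive_normc => e e0.
have pos : 0 < expR (complex.Re z) by exact: expR_gt0.
have [|d d0 dP] := @cexp_near0 R (e / expR (complex.Re z)); first exact: divr_gt0.
exists d => // h /dP; have -> : cexp (h + z) - cexp z - cexp z * h =
  cexp z * (cexp h - 1 - h) by rewrite cexpD; ring.
rewrite Normc.normcM normc_cexp -(ler_pM2l pos).
by rewrite mulrA [_ * (e / _)]mulrC divfK // gt_eqF.
Qed.

(** The restriction to the real line of a complex differentiable function is
    differentiable, with the restricted derivative. This transfers all the
    differential calculus along the segment of integration to complex functions. *)
Lemma has_derive_Re (G : C -> C) x l : has_derive G x%:C l ->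
  is_derive x 1 (fun u => complex.Re (G u%:C)) (complex.Re l).
Proof.
move=> /has_derive_normc Gl; apply/has_deriveP => e /Gl[d d0 dP].
exists d => // h hd.
have := dP h%:C; rewrite !normc_real => /(_ hd); apply: le_trans.
apply: le_trans (ler_normc_Re _); rewrite rmorphD /= !raddfB /=.
have -> // : complex.Re (l * h%:C) = complex.Re l * h.
by case: (l) => a b /=; rewrite mulr0 subr0.
Qed.

Lemma has_derive_Im (G : C -> C) x l : has_derive G x%:C l ->
  is_derive x 1 (fun u => complex.Im (G u%:C)) (complex.Im l).
Proof.
move=> Gl; have := has_derive_Re (has_deriveMl (- 'i) Gl).
have ImE w : complex.Re (- 'i * w) = complex.Im w.
  by case: w => a b /=; ring.
by rewrite ImE; under eq_fun do rewrite ImE.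
Qed.

Definition cintegrable (g : R -> C) :=
  mu.-integrable `[0, 1]%classic (EFin \o (fun u => complex.Re (g u))) /\
  mu.-integrable `[0, 1]%classic (EFin \o (fun u => complex.Im (g u))).

Definition entire (G : C -> C) := forall w, exists l, has_derive G w l.

Lemma is_derive_continuous (f f' : R -> R) :
  (forall x, is_derive x 1 f (f' x)) -> continuous f.
Proof.
by move=> df x; apply/differentiable_continuous/derivable1_diffP; case: (df x).
Qed.

Lemma entire_Re_continuous G : entire G ->
  continuous (fun u : R => complex.Re (G u%:C)).
Proof.
move=> entG x; have [l /has_derive_Re[dG _]] := entG x%:C.
exact/differentiable_continuous/derivable1_diffP.
Qed.

Lemma entire_Im_continuous G : entire G ->
  continuous (fun u : R => complex.Im (G u%:C)).
Proof.
move=> entG x; have [l /has_derive_Im[dG _]] := entG x%:C.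
exact/differentiable_continuous/derivable1_diffP.
Qed.

Lemma entire_cintegrable G : entire G -> cintegrable (fun u => G u%:C).
Proof.
move=> entG; split; apply: continuous_compact_integrable.
- exact: segment_compact.
- by apply: continuous_subspaceT; apply: entire_Re_continuous.
- exact: segment_compact.
- by apply: continuous_subspaceT; apply: entire_Im_continuous.
Qed.

Lemma cintegral01B f g : cintegrable f -> cintegrable g ->
  cintegrable (fun u => f u - g u) /\
  cintegral01 (fun u => f u - g u) = cintegral01 f - cintegral01 g.
Proof.
move=> [fr fi] [gr gi].
have ReB : (fun u => complex.Re (f u - g u)) =
           (fun u => complex.Re (f u) - complex.Re (g u)).
  by apply/funext => u; rewrite raddfB.
have ImB : (fun u => complex.Im (f u - g u)) =
           (fun u => complex.Im (f u) - complex.Im (g u)).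
  by apply/funext => u; rewrite raddfB.
have mI : measurable (`[0, 1]%classic : set (measurableTypeR R)).
  exact: measurable_itv.
split.
  have intB (a b : R -> R) : mu.-integrable `[0, 1]%classic (EFin \o a) ->
      mu.-integrable `[0, 1]%classic (EFin \o b) ->
      mu.-integrable `[0, 1]%classic (EFin \o (fun u => a u - b u)).
    move=> ia ib; have := integrableB mI ia ib.
    by congr (mu.-integrable _ _); apply/funext => u; rewrite /= EFinB.
  by split; rewrite ?ReB ?ImB; apply: intB.
by rewrite /cintegral01 ReB ImB !RintegralB.
Qed.

(** The factor 2 comes from bounding real and imaginary parts separately. *)
Lemma cintegral01_le f M : cintegrable f ->
  (forall u, 0 <= u <= 1 -> N (f u) <= M) -> N (cintegral01 f) <= 2 * M.
Proof.
move=> [fr fi] fM.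
have mI : measurable (`[0, 1]%classic : set (measurableTypeR R)).
  exact: measurable_itv.
have bnd (g : R -> R) : mu.-integrable `[0, 1]%classic (EFin \o g) ->
    (forall u, 0 <= u <= 1 -> `|g u| <= M) ->
    `|\int[mu]_(u in `[0, 1]) g u| <= M.
  move=> gi gM; apply: (le_trans (le_normr_Rintegral mI gi)).
  have -> : M = \int[mu]_(u in `[0, 1]) M.
    rewrite Rintegral_cst //.
    by rewrite /= lebesgue_measure_itv /= lte01 oppr0 adde0 mulr1.
  apply: le_Rintegral => //; first exact: integrable_norm.
    apply: continuous_compact_integrable; first exact: segment_compact.
    by apply: continuous_subspaceT; apply: cst_continuous.
rewrite /cintegral01; set a := Rintegral _ _ _; set b := Rintegral _ _ _.
have -> : a +i* b = a%:C + 0 +i* b.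
  by apply/eqP; rewrite eq_complex /= addr0 add0r !eqxx.
rewrite (le_trans (le_normcD _ _)) // normc_real normc_im mulr_natl mulr2n.
by apply: lerD; apply: bnd => // u /fM; apply: le_trans;
   [exact: ler_normc_Re | exact: ler_normc_Im].
Qed.

Lemma cintegral01_FTC (G g : C -> C) :
  (forall w, has_derive G w (g w)) -> entire g ->
  cintegral01 (fun u => g u%:C) = G 1 - G 0.
Proof.
move=> dG entg.
have ftc (F f : R -> R) : (forall x, is_derive x 1 F (f x)) -> continuous f ->
    \int[mu]_(u in `[0, 1]) f u = F 1 - F 0.
  move=> dF cf; rewrite /Rintegral (@continuous_FTC2 _ f F) //.
  - by apply: continuous_subspaceT.
  - have cF := is_derive_continuous dF; split.
    + by move=> x _; case: (dF x).
    + exact/cvg_at_right_filter/cF.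
    + exact/cvg_at_left_filter/cF.
  - by move=> x _; rewrite derive1E; apply: derive_val.
rewrite /cintegral01.
rewrite (ftc _ _ (fun x => has_derive_Re (dG x%:C)) (entire_Re_continuous entg)).
rewrite (ftc _ _ (fun x => has_derive_Im (dG x%:C)) (entire_Im_continuous entg)).
by rewrite rmorph0 rmorph1; case: (G 1) (G 0) => [a b] [c d].
Qed.

End ErfiDerive.

Section ErfiTaylor.
Variable R : realType.
Local Open Scope complex_scope.
Local Notation C := R[i].
Local Notation N := (@Normc.normc R).
Implicit Types (z w h v : C) (x y e d : R).

Lemma has_derive_gauss (a w : C) :
  has_derive (fun w => cexp ((w * a) ^+ 2)) w
             (cexp ((w * a) ^+ 2) * (2 * (w * a) * a)).
Proof.
apply: has_derive_comp (has_derive_cexp _) (has_derive_sqr _).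
by apply: (is_derive_eq (has_deriveM (has_derive_id w) (has_derive_cst a w))); ring.
Qed.

Lemma entire_cst (c : C) : entire (fun=> c).
Proof. by move=> w; exists 0; apply: has_derive_cst. Qed.

Lemma entire_id : entire (fun w : C => w).
Proof. by move=> w; exists 1; apply: has_derive_id. Qed.

Lemma entireM (f g : C -> C) : entire f -> entire g -> entire (fun w => f w * g w).
Proof.
move=> ef eg w; have [a fa] := ef w; have [b gb] := eg w.
by eexists; apply: has_deriveM fa gb.
Qed.

Lemma entireD (f g : C -> C) : entire f -> entire g -> entire (fun w => f w + g w).
Proof.
move=> ef eg w; have [a fa] := ef w; have [b gb] := eg w.
by exists (a + b); apply: (is_deriveD fa gb).
Qed.

Lemma entire_gauss (a : C) : entire (fun w => cexp ((w * a) ^+ 2)).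
Proof. by move=> w; eexists; apply: has_derive_gauss. Qed.

(** The increment of [z e^((uz)^2)] in [z]. The term linear in [h] has the
    primitive [h u e^((uz)^2)] in [u]. *)
Lemma gauss_increment (z h : C) (u : C) :
  let E := cexp ((u * z) ^+ 2) in
  let v := 2 * (u * z) * (u * h) + (u * h) ^+ 2 in
  (h + z) * cexp ((u * (h + z)) ^+ 2) - z * E
    - h * (1 * E + u * (E * (2 * (u * z) * z))) =
  E * (z * (cexp v - 1 - v + (u * h) ^+ 2) + h * (cexp v - 1 - v + v)).
Proof.
move=> E v; have -> : (u * (h + z)) ^+ 2 = (u * z) ^+ 2 + v by rewrite /v; ring.
by rewrite cexpD -/E; move: (cexp v) => ev; rewrite /v; ring.
Qed.

Lemma normc_gauss_le z x : 0 <= x <= 1 ->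
  N (cexp ((x%:C * z) ^+ 2)) <= expR `|complex.Re (z ^+ 2)|.
Proof.
move=> /andP[x0 x1]; rewrite normc_cexp ler_expR.
have -> : complex.Re ((x%:C * z) ^+ 2) = x ^+ 2 * complex.Re (z ^+ 2).
  by case: z => a b; rewrite !expr2 /=; ring.
apply: le_trans (ler_norm _) _; rewrite normrM ger0_norm ?sqr_ge0 //.
by rewrite ler_piMl // exprn_ile1.
Qed.

(** Differentiation under the integral sign. The integral over [u] of the part
    linear in [h] of the increment is [h e^(z^2)] by the fundamental theorem of
    calculus. By gauss_increment the remainder is governed by
    [e^v - 1 - v] with [v = O(h)], so it is [o(h)] uniformly in [u] as soon as
    the exponential is differentiable at the origin. *)
Lemma has_derive_integral_gauss z :
  has_derive (fun z => cintegral01 (fun x => z * cexp ((x%:C * z) ^+ 2))) z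
             (cexp (z ^+ 2)).
Proof.
apply/has_derive_normc => e e_gt0.
pose B := expR `|complex.Re (z ^+ 2)|; pose M := 2 * N z + 1.
have B_gt0 : 0 < B by exact: expR_gt0.
have z_ge0 : 0 <= N z by rewrite normc_ge0.
have M_ge1 : 1 <= M by rewrite /M; lra.
have M_gt0 : 0 < M by lra.
(* chosen so that the four error terms add up to at most e/2 *)
pose t := e / (8 * B * M ^+ 2 * (1 + e)).
have den_gt0 : 0 < 8 * B * M ^+ 2 * (1 + e).
  by rewrite !mulr_gt0 ?exprn_gt0 //; lra.
have t_gt0 : 0 < t by exact: divr_gt0.
have [d d_gt0 dP] := @cexp_near0 R t t_gt0.
exists (Num.min 1 (Num.min t (d / M))).
  by rewrite !lt_min ltr01 t_gt0 divr_gt0.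
move=> h; rewrite !lt_min => /and3P[h1 ht hd].
have h_ge0 : 0 <= N h by rewrite normc_ge0.
pose g w := h * (1 * cexp ((w * z) ^+ 2)
                 + w * (cexp ((w * z) ^+ 2) * (2 * (w * z) * z))).
have dG w : has_derive (fun w => h * (w * cexp ((w * z) ^+ 2))) w (g w).
  exact: has_deriveMl (has_deriveM (has_derive_id w) (has_derive_gauss z w)).
have entG a : entire (fun w => a * cexp ((w * a) ^+ 2)).
  exact: entireM (entire_cst a) (entire_gauss a).
have entg : entire g.
  have eE := entire_gauss z.
  apply: entireM (entire_cst h) (entireD (entireM (entire_cst 1) eE) _).
  apply: entireM entire_id (entireM eE (entireM _ (entire_cst z))).
  exact: entireM (entire_cst 2) (entireM entire_id (entire_cst z)).
have FTC := cintegral01_FTC dG entg.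
have [int1 eq1] := cintegral01B (entire_cintegrable (entG (h + z)))
                                (entire_cintegrable (entG z)).
have [int2 eq2] := cintegral01B int1 (entire_cintegrable entg).
have -> : cexp (z ^+ 2) * h = h * (1 * cexp ((1 * z) ^+ 2))
    - h * (0 * cexp ((0 * z) ^+ 2)) by rewrite !mul1r mul0r; ring.
rewrite -FTC -eq1 -eq2.
have -> : e * N h = 2 * (e / 2 * N h) by field.
apply: cintegral01_le int2 _ => x x01.
pose v := 2 * (x%:C * z) * (x%:C * h) + (x%:C * h) ^+ 2.
pose E := cexp ((x%:C * z) ^+ 2).
rewrite /g gauss_increment -/v -/E Normc.normcM.
have xh : N (x%:C * h) <= N h.
  rewrite Normc.normcM normc_real; case/andP: x01 => x0 x1.
  by rewrite ger0_norm // ler_piMl.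
have xz : N (x%:C * z) <= N z.
  rewrite Normc.normcM normc_real; case/andP: x01 => x0 x1.
  by rewrite ger0_norm // ler_piMl.
have xh2 : N ((x%:C * h) ^+ 2) <= N h ^+ 2.
  by rewrite expr2 Normc.normcM -expr2 ler_sqr ?nnegrE ?normc_ge0.
have vM : N v <= N h * M.
  have N2 : N 2 = 2.
    rewrite -[2]/(2%:R) -(rmorph_nat (@real_complex R)).
    by rewrite normc_real normr_nat.
  have N2E : N (2 * (x%:C * z) * (x%:C * h)) = 2 * (N (x%:C * z) * N (x%:C * h)).
    by rewrite (Normc.normcM (2 * _)) (Normc.normcM 2) N2 mulrA.
  rewrite (le_trans (le_normcD _ _)) // N2E.
  have := ler_pM (normc_ge0 _) (normc_ge0 _) xz xh.
  have : N h ^+ 2 <= N h by rewrite expr2 ler_piMl // ltW.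
  rewrite /M; lra.
have vd : N v < d by rewrite (le_lt_trans vM) // -ltr_pdivlMr.
have {dP}vP := dP v vd.
have EB : N E <= B by exact: normc_gauss_le.
have tM : N (cexp v - 1 - v) <= t * (N h * M).
  by rewrite (le_trans vP) // ler_pM2l.
apply: (@le_trans _ _ (B * (4 * t * M ^+ 2 * N h))); last first.
  have -> : B * (4 * t * M ^+ 2 * N h) = e / 2 * N h / (1 + e).
    rewrite /t; field.
    by rewrite !gt_eqF //; lra.
  rewrite ler_pdivrMr; last lra.
  by rewrite ler_peMr ?mulr_ge0 //; lra.
rewrite ler_pM ?normc_ge0 //.
rewrite (le_trans (le_normcD _ _)) // !Normc.normcM.
have n1 : N (cexp v - 1 - v + (x%:C * h) ^+ 2) <= t * (N h * M) + N h ^+ 2.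
  by rewrite (le_trans (le_normcD _ _)) // lerD.
have n2 : N (cexp v - 1 - v + v) <= t * (N h * M) + N h * M.
  by rewrite (le_trans (le_normcD _ _)) // lerD.
have zM : N z <= M by rewrite /M; lra.
have := ler_pM (normc_ge0 _) (normc_ge0 _) zM n1.
have := ler_wpM2l h_ge0 n2.
have hh : N h * N h <= t * N h by rewrite ler_wpM2r // ltW.
have tn_ge0 : 0 <= t * N h by rewrite mulr_ge0 // ltW.
have tM1 : t * N h * M <= t * N h * M ^+ 2.
  by rewrite expr2 mulrA ler_peMr // mulr_ge0 // ltW.
have b1 : M * (N h ^+ 2) <= t * N h * M.
  by rewrite expr2 mulrC ler_wpM2r // ltW.
have b2 : N h * (N h * M) <= t * N h * M.
  by rewrite mulrA ler_wpM2r // ltW.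
have b3 : N h * (t * (N h * M)) <= t * N h * M.
  rewrite [t * (_ * _)]mulrA; apply: ler_piMl (ltW h1).
  by rewrite mulr_ge0 // ltW.
have -> : 4 * t * M ^+ 2 * N h = 4 * (t * N h * M ^+ 2) by ring.
rewrite (mulrDr M (t * _)) (mulrDr (N h) (t * _)).
have -> : M * (t * (N h * M)) = t * N h * M ^+ 2 by ring.
lra.
Qed.

Lemma has_derive_erfi z :
  has_derive (@erfi R) z (2 / csqrtpi R * cexp (z ^+ 2)).
Proof. exact: has_deriveMl (has_derive_integral_gauss z). Qed.

End ErfiTaylor.

Section GaussTaylor.
Variable K : numFieldType.
Implicit Types (z c : K).

(** [q_n] with [(d/dz)^n e^(z^2) = q_n(z) e^(z^2)]. *)
Fixpoint gauss_poly (n : nat) : {poly K} :=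
  if n is m.+1 then (gauss_poly m)^`() + 2 *: ('X * gauss_poly m) else 1.

Lemma gauss_polyS n :
  gauss_poly n.+1 = (gauss_poly n)^`() + 2 *: ('X * gauss_poly n).
Proof. by []. Qed.

(** As for Hermite polynomials, [q_n' = 2n q_(n-1)] turns the definition into a
    three-term recurrence. *)
Lemma deriv_gauss_poly n :
  (gauss_poly n.+1)^`() = (2 * n.+1%:R) *: gauss_poly n.
Proof.
elim: n => [|n IH].
  rewrite /= (_ : 1^`() = 0 :> {poly K}); last by rewrite -polyC1 derivC.
  by rewrite add0r mulr1 derivZ derivX mulr1.
rewrite gauss_polyS derivD derivZ derivM derivX mul1r IH derivZ gauss_polyS.
by rewrite -!mul_polyC -!natr1 !rmorphM !rmorphD /=; ring.
Qed.

Lemma derive1n_gauss (g : K -> K) c n :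
    (forall z, has_derive g z (2 * z * g z)) ->
  (derive1n n (fun z => c * g z))%classic = (fun z => c * ((gauss_poly n).[z] * g z)).
Proof.
move=> dg; elim: n => [|n IH].
  by rewrite derive1n0; apply/funext => z; rewrite hornerC mul1r.
rewrite derive1nS IH; apply/funext => z; apply: has_derive1.
apply: (is_derive_eq (has_deriveMl c (has_deriveM (has_derive_horner _ z) (dg z)))).
by rewrite gauss_polyS hornerD hornerZ hornerM hornerX; ring.
Qed.

Lemma fps_deriv_taylor (f : K -> K) z :
  fps_deriv (taylor f z) = taylor (f^`()%classic) z.
Proof.
apply/funext => n; rewrite /fps_deriv /taylor derive1Sn factS natrM -mulr_natr.
by field; rewrite nat1r !pnatr_eq0 -lt0n fact_gt0.
Qed.

(** The Taylor series of a multiple of [e^(z^2)] at [z] inherits its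
    differential equation. *)
Lemma taylor_gauss_ode (g : K -> K) c z :
    (forall z, has_derive g z (2 * z * g z)) ->
  fps_deriv (taylor (fun z => c * g z) z) =
  2 * (fpsC z + fpsX) * taylor (fun z => c * g z) z.
Proof.
move=> dg; have step n : (gauss_poly n.+2).[z] =
    2 * z * (gauss_poly n.+1).[z] + 2 * n.+1%:R * (gauss_poly n).[z].
  rewrite gauss_polyS deriv_gauss_poly hornerD !hornerZ hornerM hornerX.
  by rewrite addrC mulrA.
have tayE n : taylor (fun z => c * g z) z n =
    c * ((gauss_poly n).[z] * g z) / (n`!)%:R.
  by rewrite /taylor derive1n_gauss.
apply/funext => n; rewrite /fps_deriv -(rmorph_nat (@fpsC K)) -mulrA fps_coefCM.
rewrite (mulrDl (fpsC z)) fps_coefD fps_coefCM fps_coefXM tayE.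
case: n => [|n]; rewrite !tayE.
  have -> : (gauss_poly 1).[z] = 2 * z * (gauss_poly 0).[z].
    rewrite gauss_polyS (_ : (gauss_poly 0)^`() = 0); last by rewrite -(derivC 1).
    by rewrite add0r hornerZ hornerM hornerX mulrA.
  by rewrite mulr1n !divr1; ring.
rewrite step !factS !natrM -mulr_natr.
field.
by rewrite nat1r -natrD !pnatr_eq0 -lt0n fact_gt0.
Qed.

End GaussTaylor.

(** * The two families *)

Section Families.
Variable K : numFieldType.
Local Notation H := (@hermite K).
Local Notation S := (@fps_invsqrt1mX2 K).

Lemma fps_deriv_exp : fps_deriv (@fps_exp K) = fps_exp.
Proof.
apply/funext => n; rewrite /fps_deriv /fps_exp factS natrM -mulr_natr.
by field; rewrite nat1r !pnatr_eq0 -lt0n fact_gt0.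
Qed.

(** Members of the first family before the normalization of [alpha_1]. *)
Lemma is_genfun_A1 (al : nat -> K) : (forall n, al n != 0) -> al 0%N = 1 ->
    (forall n, al n.+2 *+ n.+2 = al n.+1) ->
  is_genfun H (Genfun al 1 (fpsC 4^-1 * fpsX ^+ 2) al).
Proof.
move=> al_neq0 al0 rec; apply: (@is_genfun_hermite K _ 1 _ 0 4^-1) => //.
- by rewrite fps_coefCM fps_coefX0 /fpsX /= expr0n mulr0.
- by rewrite mulr0 rmorph0 !mul0r subr0 mul1r fps_deriv1.
- rewrite mulr0 rmorph0 mul0r subr0 mul1r fps_derivCM fps_derivXn fps_derivX.
  by rewrite -(rmorph_nat (@fpsC K)) !mulr1 expr1 rmorphM mulrCA mulrA.
- by move=> n; rewrite rec; field.
Qed.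

Lemma is_genfun_exp : is_genfun H
  (Genfun (fun n => (n`!)%:R^-1) 1 (fpsC 4^-1 * fpsX ^+ 2) fps_exp).
Proof.
apply: is_genfun_A1 => [n||n]; last first.
- rewrite (factS n.+1) natrM -mulr_natr.
  by field; rewrite -natrD !pnatr_eq0 -lt0n fact_gt0.
- by rewrite fact0 invr1.
- by rewrite invr_eq0 pnatr_eq0 -lt0n fact_gt0.
Qed.

Lemma genfun_series_A1 (al : nat -> K) (c : K) (F : fps K) :
  genfun_series (Genfun al 1 (fpsC c * fpsX ^+ 2) F) =
  fps_comp (fps_lift F) (fpsX * fpsC 'X - fpsC c%:P * fpsX ^+ 2).
Proof.
rewrite /genfun_series /= rmorph1 mul1r mulr1 rmorphM rmorphXn /=.
by rewrite fps_liftC fps_liftX mulrC.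
Qed.

(** The numbers alpha_n of the second family, as a function of the free first
    coefficient. *)
Definition hermite_alpha (rho a : K) n : K :=
  2 ^+ n / (n`!)%:R *
  ((H n).[rho] + (a / 2 - rho) * (assoc_hermite_pred 1 n).[rho]).

Lemma hermite_alpha0 (rho a : K) : hermite_alpha rho a 0 = 1.
Proof.
by rewrite /hermite_alpha hermite0 /assoc_hermite_pred /= hornerC horner0 mulr0
  addr0 expr0 fact0 divr1 mul1r.
Qed.

Lemma hermite_alpha1 (rho a : K) : hermite_alpha rho a 1 = a.
Proof.
rewrite /hermite_alpha hermite1 /assoc_hermite_pred /= hornerX hornerC mulr1.
by rewrite divr1; field.
Qed.

Lemma hermite_alphaSS (rho a : K) n : hermite_alpha rho a n.+2 *+ n.+2 =
  2 * rho * hermite_alpha rho a n.+1 - 2 * hermite_alpha rho a n.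
Proof.
rewrite /hermite_alpha hermiteSS /assoc_hermite_pred !assoc_hermite_pairS /=.
rewrite !(hornerD, hornerN, hornerZ, hornerM, hornerX).
set h1 := (H n.+1).[rho]; set h0 := (H n).[rho].
set k1 := (assoc_hermite_pair 1 n).1.[rho]; set k0 := (assoc_hermite_pair 1 n).2.[rho].
rewrite !factS !natrM -mulr_natr !exprS.
by field; rewrite nat1r -natrD !pnatr_eq0 -lt0n fact_gt0.
Qed.

Lemma hermite_alpha_unique (rho a : K) (al : nat -> K) :
    al 0%N = 1 -> al 1%N = a ->
    (forall n, al n.+2 *+ n.+2 = 2 * rho * al n.+1 - 2 * al n) ->
  al = hermite_alpha rho a.
Proof.
move=> al0 al1 rec; apply/funext => n.
suff: al n = hermite_alpha rho a n /\ al n.+1 = hermite_alpha rho a n.+1 by case.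
elim: n => [|n [IH0 IH1]]; first by rewrite hermite_alpha0 hermite_alpha1.
split=> //; apply: (mulrSn_inj (@pchar_num K) (n := n.+1)) => /=.
by rewrite rec hermite_alphaSS IH0 IH1.
Qed.

Lemma is_genfun_hermite_alpha (rho a : K) :
    (forall n, hermite_alpha rho a n != 0) ->
  is_genfun H (Genfun (hermite_alpha rho a) S (fpsC rho * (S - 1))
                      (hermite_alpha rho a)).
Proof.
move=> al_neq0; apply: (@is_genfun_hermite K _ _ _ 2^-1 (rho / 2)) => //.
- exact: hermite_alpha0.
- exact: fps_invsqrt1mX2_0.
- by rewrite fps_coefCM fps_coefB fps_invsqrt1mX2_0 fps_coef1 subrr mulr0.
- by rewrite mulfV ?pnatr_eq0 // rmorph1 !mul1r fps_invsqrt1mX2_ode.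
- rewrite mulfV ?pnatr_eq0 // rmorph1 mul1r fps_derivCM fps_derivB fps_deriv1.
  have -> : 2 * (rho / 2) = rho by field.
  by rewrite subr0 mulrCA fps_invsqrt1mX2_ode mulrA.
- by move=> n; rewrite hermite_alphaSS; field.
Qed.

Section ErfiFamily.
Variables (rho kappa er : K) (erf : fps K).
Let W := fpsC er - fps_comp erf (- fpsX).
Let Q : fps K := fpsX * (fpsC (2 * rho) - fpsX).
Let E := fps_comp fps_exp Q.
Let F := (1 + fpsC kappa * W) * E.

Lemma fps_negX_0 : (- fpsX : fps K) 0%N = 0.
Proof. by rewrite fps_coefN oppr0. Qed.

Lemma erfi_exponent_0 : Q 0%N = 0.
Proof. by rewrite /Q fps_coefM0 mul0r. Qed.

(** [W' = V] is a multiple of [exp((rho - t)^2)], and [E = exp(rho^2 - (rho - t)^2)]: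
    their product is constant, so that [F = (1 + kappa W) E] satisfies a linear
    differential equation with a constant right-hand side. *)
Lemma erfi_family_ode (g : fps K) : fps_deriv erf = g ->
    fps_deriv g = 2 * (fpsC rho + fpsX) * g ->
  fps_deriv F = 2 * (fpsC rho - fpsX) * F + fpsC (kappa * g 0%N).
Proof.
move=> derf dg; pose V := fps_comp g (- fpsX).
have dNX : fps_deriv (- fpsX : fps K) = -1 by rewrite fps_derivN fps_derivX.
have dW : fps_deriv W = V.
  rewrite /W fps_derivB fps_derivC fps_deriv_comp ?fps_negX_0 // derf dNX.
  by rewrite mulrN1 sub0r opprK.
have dV : fps_deriv V = - (2 * (fpsC rho - fpsX) * V).
  rewrite /V fps_deriv_comp ?fps_negX_0 // dg dNX.
  rewrite -(rmorph_nat (@fpsC K)) -mulrA fps_compCM.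
  rewrite (fps_compM (@pchar_num K)) ?fps_negX_0 // fps_compD fps_compC.
  by rewrite fps_compX ?fps_negX_0 // mulrN1 mulrA.
have dE : fps_deriv E = 2 * (fpsC rho - fpsX) * E.
  rewrite /E fps_deriv_comp ?erfi_exponent_0 // fps_deriv_exp /Q fps_derivM.
  rewrite fps_derivB fps_derivC fps_derivX rmorphM (rmorph_nat (@fpsC K)) /=.
  by ring.
have VE : V * E = fpsC (g 0%N).
  apply: (fps_eq_deriv (@pchar_num K)).
    by rewrite fps_coefM0 /V /E !fps_comp0 /fps_exp fact0 invr1 mulr1.
  by rewrite fps_derivC fps_derivM dV dE; ring.
rewrite /F fps_derivM fps_derivD fps_deriv1 fps_derivCM dW dE add0r -mulrA VE.
by rewrite rmorphM /=; ring.
Qed.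

Lemma erfi_family_coef (g : fps K) (a : K) : fps_deriv erf = g ->
    fps_deriv g = 2 * (fpsC rho + fpsX) * g ->
    erf 0%N = er -> kappa * g 0%N = a - 2 * rho ->
  F = hermite_alpha rho a.
Proof.
move=> derf dg erf0 kg; have ode := erfi_family_ode derf dg.
have F0 : F 0%N = 1.
  rewrite /F /W /E fps_coefM0 fps_coefD fps_coefCM fps_coefB !fps_comp0 erf0 subrr.
  by rewrite mulr0 addr0 mul1r /fps_exp fact0 invr1.
have rec n : F n.+1 *+ n.+1 = 2 * (rho * F n - (fpsX * F) n) + fpsC (a - 2 * rho) n.
  rewrite -[LHS]/(fps_deriv F n) ode kg -(rmorph_nat (@fpsC K)) fps_coefD -mulrA.
  by rewrite fps_coefCM (mulrBl F) fps_coefB fps_coefCM.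
apply: hermite_alpha_unique => //.
  by have := rec 0%N; rewrite mulr1n F0 fps_coefXM mulr1 subr0 addrC subrK.
by move=> n; rewrite rec fps_coefXM addr0; ring.
Qed.

(** With [z = xtA - R] and [A = (1 - t^2)^(-1/2)], the closed form amounts to
    [rho - z = (rho - xt) A] and hence
    [2 rho z - z^2 = rho^2 - (rho - xt)^2 / (1 - t^2)]. *)
Lemma erfi_family_closed_form (al : nat -> K) :
  genfun_series (Genfun al S (fpsC rho * (S - 1)) F) =
  fps_lift S *
  (1 + fpsC kappa%:P *
       (fpsC er%:P -
        fps_comp_at rho%:P (fps_lift erf)
          ((fpsC rho%:P - fpsX * fpsC 'X) * fps_lift S))) *
  fps_comp (fps_lift fps_exp)
    ((fpsC (2 * rho%:P * 'X) * fpsX - fpsC ('X ^+ 2 + (rho ^+ 2)%:P) * fpsX ^+ 2)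
     * fps_lift (fps_pow1mX2 (- 1))).
Proof.
have charP : [pchar {poly K}] =i pred0.
  by move=> p; rewrite pchar_poly pchar_num.
rewrite /genfun_series /=.
have -> : fps_lift F = (1 + fpsC kappa%:P *
    (fpsC er%:P - fps_comp (fps_lift erf) (- fpsX))) *
    fps_comp (fps_lift fps_exp) (fpsX * (fpsC (2 * rho)%:P - fpsX)).
  rewrite /F /W /E /Q rmorphM rmorphD rmorph1 rmorphM rmorphB /= !fps_lift_comp rmorphN.
  by rewrite rmorphM rmorphB /= !fps_liftC !fps_liftX.
rewrite [fps_lift (_ * _)]rmorphM rmorphB rmorph1 /= fps_liftC.
set T := fps_lift S.
set z := fpsC 'X * fpsX * T - _.
have z0 : z 0%N = 0.
  rewrite /z fps_coefB !fps_coefM0 fps_coefB /T /fps_lift fps_invsqrt1mX2_0.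
  by rewrite /fpsX /= mulr0 mul0r subrr mulr0 subrr.
have sqrT : (1 - fpsX ^+ 2) * T ^+ 2 = 1.
  rewrite -[RHS](rmorph1 (@fps_lift K)) -(fps_invsqrt1mX2_sqr K).
  by rewrite rmorphM rmorphB rmorph1 !rmorphXn /= fps_liftX.
have powE : fps_lift (fps_pow1mX2 (-1)) = T ^+ 2.
  have := congr1 (@fps_lift K) (fps_pow1mX2_N1 K).
  rewrite rmorphM rmorphB !rmorph1 rmorphXn /= fps_liftX => powV.
  by rewrite -[LHS]mulr1 -sqrT mulrA [_ * (1 - _)]mulrC powV mul1r.
have NX0 : (- fpsX : fps {poly K}) 0%N = 0 by rewrite fps_coefN oppr0.
have Q0 : (fpsX * (fpsC (2 * rho)%:P - fpsX) : fps {poly K}) 0%N = 0.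
  by rewrite fps_coefM0 mul0r.
rewrite powE (fps_compM charP) // fps_compD fps_compCM fps_compD fps_compN.
rewrite (fps_compC 1 z : fps_comp 1 z = 1) fps_compC.
rewrite !(fps_compA charP) // (fps_compM charP) // fps_compD !fps_compN.
rewrite fps_compC fps_compX // -mulrA /fps_comp_at.
have zE : (fpsC rho%:P - fpsX * fpsC 'X) * T - fpsC rho%:P = - z.
  by rewrite /z; ring.
rewrite zE; congr (_ * (_ * fps_comp _ _)).
have zE' : (fpsC rho%:P - fpsX * fpsC 'X) * T = fpsC rho%:P - z.
  by rewrite -zE [RHS]addrC subrK.
transitivity ((fpsC rho%:P) ^+ 2 - ((fpsC rho%:P - fpsX * fpsC 'X) * T) ^+ 2).
  by rewrite zE' !rmorphM /= !rmorph_nat; ring.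
transitivity ((fpsC rho%:P) ^+ 2 * ((1 - fpsX ^+ 2) * T ^+ 2)
   - ((fpsC rho%:P - fpsX * fpsC 'X) * T) ^+ 2); first by rewrite sqrT mulr1.
by rewrite rmorphD !rmorphM /= ?rmorphXn /= !rmorph_nat; ring.
Qed.

End ErfiFamily.
End Families.

(** * Classification *)

Section Classification.
Variable K : numClosedFieldType.
Local Notation H := (@hermite K).
Local Notation S := (@fps_invsqrt1mX2 K).
Implicit Types (D : genfun K).

(** The case [A_2 <> 0]: a dilation makes [A_2 = 1/2]. *)
Lemma classify_A2_neq0 D : is_genfun H D -> gf_A D 2%N != 0 ->
  exists2 D', up_to_normalization D D' &
    exists rho a : K, (forall n, hermite_alpha rho a n != 0) /\
      D' = Genfun (hermite_alpha rho a) S (fpsC rho * (S - 1)) (hermite_alpha rho a).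
Proof.
move=> gD A2; pose c := sqrtC (2 * gf_A D 2%N)^-1.
have c2 : c ^+ 2 * gf_A D 2%N = 2^-1.
  by rewrite sqrtCK; field.
have c_neq0 : c != 0.
  by rewrite sqrtC_eq0 invr_eq0 mulf_neq0 ?pnatr_eq0.
have gD' := is_genfun_rescale c_neq0 gD.
exists (gf_rescale c D); first exact/rt_step/StepRescale.
have [_ _ rec] := hermite_genfun_rec gD'.
have [_ [al_neq0 al0] _ _ _] := gD'.
pose rho := 2 * gf_R (gf_rescale c D) 2%N.
have alE : gf_alpha (gf_rescale c D) =
    hermite_alpha rho (gf_alpha (gf_rescale c D) 1%N).
  apply: hermite_alpha_unique => // n; rewrite rec.
  rewrite [gf_A _ 2%N](_ : _ = 2^-1); last by rewrite -c2.
  by rewrite /rho; field.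
exists rho, (gf_alpha (gf_rescale c D) 1%N); rewrite -alE; split=> //.
apply: genfun_hermite_inj gD' _ _ => //; rewrite alE.
by apply: is_genfun_hermite_alpha; rewrite -alE.
Qed.

(** The case [A_2 = 0]: a dilation makes [R_2 = 1/4], then [alpha_n] is
    [alpha_1 / n!] for [n > 0] and [A = 1] by rigidity, so that [alpha_1] can
    be normalized to 1. *)
Lemma classify_A2_eq0 D : is_genfun H D -> gf_A D 2%N = 0 ->
  up_to_normalization D
    (Genfun (fun n => (n`!)%:R^-1) 1 (fpsC 4^-1 * fpsX ^+ 2) fps_exp).
Proof.
move=> gD A2; have [_ _ rec0] := hermite_genfun_rec gD.
have R2 : gf_R D 2%N != 0.
  apply/eqP => R2; have [_ [al_neq0 _] _ _ _] := gD.
  have /eqP := rec0 0%N; rewrite A2 R2 !mul0r subr0 mulr0 mulrn_eq0 /=.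
  by rewrite (negPf (al_neq0 _)).
pose c := (4 * gf_R D 2%N)^-1.
have c_neq0 : c != 0 by rewrite invr_eq0 mulf_neq0 ?pnatr_eq0.
have gD' := is_genfun_rescale c_neq0 gD.
have [_ _] := hermite_genfun_rec gD'; have [_ [al_neq0 al0] _ _ _] := gD'.
set al := gf_alpha _ in al_neq0 al0 * => rec.
have A2' : gf_A (gf_rescale c D) 2%N = 0 by rewrite /= /fps_dilate A2 mulr0.
have R2' : gf_R (gf_rescale c D) 2%N = 4^-1.
  by rewrite /= fps_coefCM /fps_dilate /c; field.
have {}rec n : al n.+2 *+ n.+2 = al n.+1.
  by rewrite rec A2' R2'; field.
have alE n : al n.+1 = al 1%N / (n.+1)`!%:R.
  elim: n => [|n IH]; first by rewrite divr1.
  apply: (mulrSn_inj (@pchar_num K) (n := n.+1)) => /=.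
  rewrite rec IH (factS n.+1) natrM -[RHS]mulr_natr.
  by field; rewrite -natrD !pnatr_eq0 -lt0n fact_gt0.
pose D2 : genfun K := Genfun al 1 (fpsC 4^-1 * fpsX ^+ 2) al.
have gD2 : is_genfun H D2 by exact: is_genfun_A1.
apply: (rt_trans _ _ _ (gf_rescale c D)); first exact/rt_step/StepRescale.
rewrite (genfun_hermite_inj gD' gD2 erefl).
have k_neq0 : (al 1%N)^-1 != 0 by rewrite invr_eq0.
have := StepStretch k_neq0 (erefl : gf_A D2 = 1) => /(rt_step _ _ _ _).
congr (up_to_normalization _ _); rewrite /gf_stretch /=; congr Genfun.
  apply/funext => -[|n] /=; first by rewrite al0 fact0 invr1.
  by rewrite (alE n) mulKf.
apply/funext => n; rewrite fps_coefD fps_coefCM fps_coefB !fps_coef1 /fps_exp.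
case: n => [|n] /=; first by rewrite al0 subrr mulr0 addr0 fact0 invr1.
by rewrite subr0 add0r (alE n) mulKf.
Qed.

End Classification.

Section Main.
Variable R : realType.
Local Notation C := R[i].

Lemma genfun2E (rho a1 : C) : genfun2 rho a1 =
  Genfun (hermite_alpha rho a1) fps_invsqrt1mX2
         (fpsC rho * (fps_invsqrt1mX2 - 1)) (hermite_alpha rho a1).
Proof.
rewrite /genfun2; congr Genfun; rewrite /fps_comp_at addrAC subrr add0r.
pose g := taylor (fun z : C => 2 / csqrtpi R * cexp (z ^+ 2)) rho.
apply: (@erfi_family_coef C _ _ _ _ g).
- rewrite fps_deriv_taylor; congr taylor; apply/funext => z.
  exact: has_derive1 (has_derive_erfi z).
- apply: taylor_gauss_ode => z; apply: is_derive_eq.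
    exact: has_derive_comp (has_derive_cexp _) (has_derive_sqr (has_derive_id z)).
  by rewrite mulr1 mulrC.
- by rewrite /taylor derive1n0 fact0 divr1.
have sqrtpi_neq0 : csqrtpi R != 0.
  by rewrite eq_complex /= eqxx andbT gt_eqF // sqrtr_gt0 pi_gt0.
have cexpN : cexp (- rho ^+ 2) * cexp (rho ^+ 2) = 1 by rewrite -cexpD addNr cexp0.
rewrite /g /taylor derive1n0 fact0 divr1.
transitivity (2 * (a1 / 2 - rho) * (cexp (- rho ^+ 2) * cexp (rho ^+ 2))).
  by field.
by rewrite cexpN; field.
Qed.

Lemma genfun2_closed_form (rho a1 : C) :
  genfun_series (genfun2 rho a1) = closed_form2 rho a1.
Proof.
rewrite /genfun2 /fps_comp_at addrAC subrr add0r.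
exact: erfi_family_closed_form.
Qed.

End Main.

Theorem theorem3p2 (R : realType) :
  [/\ is_genfun (@hermite R[i]) (genfun1 R) /\
      (fun n => (n`!)%:R^-1 *: hermite n) = closed_form1 R,
      forall rho a1 : R[i], (forall n, alpha2 rho a1 n != 0) ->
        is_genfun (@hermite R[i]) (genfun2 rho a1) /\
        (fun n => (2 ^+ n / (n`!)%:R *
                   ((hermite n).[rho] +
                    (a1 / 2 - rho) * (assoc_hermite_pred 1 n).[rho]))
                  *: hermite n) = closed_form2 rho a1
    & forall D : genfun R[i], is_genfun (@hermite R[i]) D ->
        exists2 D' : genfun R[i], up_to_normalization D D' &
          D' = genfun1 R \/
          exists rho a1 : R[i],
            (forall n, alpha2 rho a1 n != 0) /\ D' = genfun2 rho a1].
Proof.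
split.
- have g1 := is_genfun_exp R[i]; split; first exact: g1.
  have [_ _ _ _ <-] := g1; exact: genfun_series_A1.
- move=> rho a1 al_neq0; have g2 : is_genfun (@hermite R[i]) (genfun2 rho a1).
    by rewrite genfun2E; apply: is_genfun_hermite_alpha.
  by split=> //; rewrite -genfun2_closed_form; have [_ _ _ _ ->] := g2.
- move=> D gD; have [A2|A2] := eqVneq (gf_A D 2%N) 0.
    by exists (genfun1 R); [exact: classify_A2_eq0 | left].
  have [D' DD' [rho [a1 [al_neq0 D'E]]]] := classify_A2_neq0 gD A2.
  by exists D' => //; right; exists rho, a1; rewrite genfun2E.
Qed.
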